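(* Let $X_1,\dots,X_n$ be independent random variables with values in measurable spaces $\mathfrak X_1,\dots,\mathfrak X_n$, respectively, let $g:\mathfrak X_1\times\dots\times\mathfrak X_n\to\mathbb R$ be a measurable function that is separately Lipschitz with respect to measurable functions $\rho_i:\mathfrak X_i\times\mathfrak X_i\to\mathbb R$, $i=1,\dots,n$, and let $Y:=g(X_1,\dots,X_n)$. Suppose that $Y$ has a finite mean. For each $i=1,\dots,n$, take any $x_i\in\mathfrak X_i$. (I) For any $f\in\mathcal F_{1,2}\setminus\{0\}$, $$\mathsf E f(Y)\le f(\mathsf E Y)+\kappa_fC_f\sum_{i=1}^n\mathsf E f\big(\rho_i(X_i,x_i)\big),$$ where $$\kappa_f:=\sup\Big\{\frac{U_f(c,s,0)}{U_f(c,s,a)}\colon s\in(0,\infty),\ c\in(0,\tfrac s2),\ a\in(0,c)\Big\}\in[1,2],$$ $$U_f(c,s,a):=c\,f(s-c+a)+(s-c)\,f(a-c).$$ (II) For any $p\in(1,2]$, $$\mathsf E|Y|^p\le|\mathsf E Y|^p+\tilde\kappa_p\tilde C_p\sum_{i=1}^n\mathsf E\big|\rho_i(X_i,x_i)\big|^p,$$ where $$\tilde\kappa_p:=\kappa_{|\cdot|^p}=\max_{c\in[0,1/2]}\Big[\big(c^{p-1}+(1-c)^{p-1}\big)\big(c^{\frac1{p-1}}+(1-c)^{\frac1{p-1}}\big)^{p-1}\Big].$$ Moreover, $\tilde\kappa_p$ continuously and strictly decreases in $p\in(1,2]$ from $2$ to $1$ (that is, $\tilde\kappa_{1+}=2$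 and $\tilde\kappa_2=1$). Furthermore, the values of $\tilde\kappa_p$ are algebraic for all rational $p\in(1,2]$; in particular, $\tilde\kappa_{3/2}=\frac19\sqrt{51+21\sqrt7}$, corresponding to $c=\frac16\big(3-\sqrt{1+2\sqrt7}\big)$ in the maximum $\max_{c\in[0,1/2]}\big[\big(c^{1/2}+(1-c)^{1/2}\big)\big(c^2+(1-c)^2\big)^{1/2}\big]$ that expresses $\tilde\kappa_{3/2}$.
   Context: $g$ is separately Lipschitz (with respect to $\rho_1,\dots,\rho_n$) if $$|g(x_1,\dots,x_{i-1},\tilde x_i,x_{i+1},\dots,x_n)-g(x_1,\dots,x_n)|\le\rho_i(\tilde x_i,x_i)$$ for all $i=1,\dots,n$, all $(x_1,\dots,x_n)\in\mathfrak X_1\times\dots\times\mathfrak X_n$, and all $\tilde x_i\in\mathfrak X_i$. $\mathcal F_{1,2}$ is the class of all continuously differentiable functions $f:\mathbb R\to\mathbb R$ such that $f(0)=0$, $f$ is even, and $f'$ is nondecreasing and concave on $[0,\infty)$ (any nonzero such $f$ is $>0$ on $\mathbb R\setminus\{0\}$). For $f\in\mathcal F_{1,2}\setminus\{0\}$, $$C_f:=\sup_{0<x<s<\infty}\frac{f(x-s)-f(x)+sf'(x)}{f(s)},$$ and $\tilde C_p:=C_{|\cdot|^p}$ for $p\in(1,2]$. Expectations of nonnegative random variables may equal $+\infty$. *)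

(* Defs.v *)
From HB Require Import structures.
From mathcomp Require Import all_boot all_order all_algebra.
From mathcomp Require Import all_classical all_reals all_analysis.

Set Implicit Arguments.
Unset Strict Implicit.
Unset Printing Implicit Defensive.

Import Order.TTheory GRing.Theory Num.Theory.
Import numFieldNormedType.Exports.

Local Open Scope classical_set_scope.
Local Open Scope ring_scope.

Section product_space.
Context {I : finType} {d : I -> measure_display}.
Variable T : forall i, measurableType (d i).

Definition cylinders : set (set (forall i, T i)) :=
  \bigcup_i preimage_set_system setT (fun x : forall j, T j => x i) measurable.

(* Dependent functions on I carrying the product sigma-algebra <<s cylinders >>. *)
Definition prodT : Type := g_sigma_algebraType cylinders.

End product_space.

Section independence.
Context {I : finType} {d : I -> measure_display}.
Context {T : forall i, measurableType (d i)}.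

Definition mutually_independent {dO} {Omega : measurableType dO}
    {R : realType} (P : probability Omega R) (X : forall i, Omega -> T i) :=
  forall (J : {set I}) (A : forall i, set (T i)),
    (forall i, measurable (A i)) ->
    P (\bigcap_(i in [set` J]) (X i @^-1` A i)) =
    (\prod_(i in J) P (X i @^-1` A i))%E.

(* [dfwith x i y] is x with its i-th coordinate replaced by y : T i. *)
Definition separately_lipschitz {R : realType}
    (rho : forall i, T i * T i -> R) (g : (forall i, T i) -> R) :=
  forall i (x : forall j, T j) (y : T i),
    `|g (dfwith x i y) - g x| <= rho i (y, x i).

End independence.

Section F12.
Context {R : realType}.
Implicit Types (f : R -> R) (p : R).

(* The last clause says that the derivative of f is concave on [0, +oo[. *)
Definition F12 f : Prop :=
  [/\ (forall x, derivable f x 1) /\ continuous (derive1 f),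
      f 0 = 0,
      (forall x, f (- x) = f x),
      {in `[0, +oo[ &, {homo derive1 f : x y / x <= y}} &
      convex_function (`[0, +oo[ : set R^o) (fun x : R^o => - derive1 f x)].

Definition C_const f : \bar R :=
  ereal_sup [set r | exists x s, 0 < x < s /\
    r = ((f (x - s) - f x + s * derive1 f x) / f s)%:E].

Definition U f (c s a : R) : R := c * f (s - c + a) + (s - c) * f (a - c).

Definition kappa f : \bar R :=
  ereal_sup [set r | exists s c a, [/\ 0 < s, 0 < c < s / 2, 0 < a < c &
    r = (U f c s 0 / U f c s a)%:E]].

Definition abs_pow p : R -> R := fun x => `|x| `^ p.

Definition kappat p : R := fine (kappa (abs_pow p)).

Definition kappat_objective p (c : R) : R :=
  (c `^ (p - 1) + (1 - c) `^ (p - 1)) *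
  (c `^ (p - 1)^-1 + (1 - c) `^ (p - 1)^-1) `^ (p - 1).

Definition is_maximum (A : set R) (m : R) : Prop := A m /\ ubound A m.

End F12.

(* Main.v *)
Require Import Defs.
From mathcomp Require Import all_boot all_order all_algebra.
From mathcomp Require Import all_classical all_reals all_analysis.
From mathcomp Require Import measurable_realfun ring lra.

(**
  Why the bounds hold.

  For f in the class F12, the derivative f' is odd, and subadditive on the
  half-line because it is concave there and vanishes at 0.  Two pointwise
  inequalities follow.

  - F12_taylor_le: f (x + d) - f x - d f' x <= C_f f d for all real x and d.
    By symmetry x >= 0.  The definition of C_f covers 0 < x < - d; in the other
    cases the left-hand side is at most f d by subadditivity, and C_f >= 1.

  - recentering_supporting_line: for every real a there is a slope l such that
    f z <= kappa_f f (z + a) + l z for all z.  Such an l exists as soon as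
    Ef(Z) <= kappa_f Ef(Z + a) for the mean-zero two-point laws of Z, which is
    the inequality U(c, s, 0) <= kappa_f U(c, s, a); symmetry, convexity and
    continuity reduce all values of c and a to those that occur in kappa_f.

  Adding them gives F12_centering_le, a bound of f t by
  f m + kappa_f C_f f (t - e) plus a multiple of t - m.  When m is the mean of
  a random variable eta, the last term integrates to 0 and
  Ef(eta) <= f(m) + kappa_f C_f Ef(eta - e).

  The variables X_1, ..., X_n are treated one at a time.  By independence,
  replacing X_k by an independent copy does not change the law of
  (X_1, ..., X_n) (pushforward_resample, integral_resample).  So g may be
  replaced by its integral over the k-th coordinate: this preserves the mean,
  costs kappa_f C_f Ef(rho_k (X_k, x_k)) in Ef(Y), and preserves the bound
  |g(.., y, ..) - g(.., x_i, ..)| <= rho_i (y, x_i).  After all coordinates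
  are integrated out, g is the constant EY.

  For f = |.|^p put r = p - 1 and N(t) = c^t + (1 - c)^t.  By homogeneity
  s = 1, and two tangent lines give min_a U(c, 1, a) = c (1 - c) / N(1/r)^r, so
  that kappa_p is the maximum of N(r) N(1/r)^r over c (kappa_abs_pow_max).

  - Monotonicity.  With phi = ln N, which is strictly convex and vanishes at
    1, the function phi(r) + r phi(1/r) is strictly decreasing on (0, 1]: the
    slopes of phi left of 1 are smaller than those right of 1
    (log_power_sum_decr).
  - Continuity.  N(1/r)^r increases with r while c^r - c^s <= (s - r) / r for
    r <= s, so kappa_p is locally Lipschitz in p (kappat_dist_le).
  - Limit at 1.  kappa_p <= 2, and kappa_p >= 2 (1 - c) (1 + r ln c) for each
    c, which tends to 2 as r -> 0 and then c -> 0.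
  - Algebraicity.  If r = a / b, the substitution c / (1 - c) = z^(ab) turns
    the b-th power of the objective into a rational function of z over Q.
    Unless it is constant, it is maximal at a root of a nonzero polynomial
    over Q.
  - p = 3/2.  The square of the objective is (1 + 2 t) (1 - 2 t^2) with
    t = sqrt (c (1 - c)), and its maximum over t >= 0 is at (sqrt 7 - 1) / 6.
*)

Set Implicit Arguments.
Unset Strict Implicit.
Unset Printing Implicit Defensive.

Import Order.TTheory GRing.Theory Num.Theory.
Import numFieldNormedType.Exports.

Local Open Scope classical_set_scope.
Local Open Scope ring_scope.

(** * Monotonicity from derivatives *)

Section mean_value.
Context {R : realType}.
Implicit Types (phi dphi : R -> R) (a b : R).

Lemma derivable_continuous phi : (forall x : R, derivable phi x 1) -> continuous phi.
Proof. by move=> d x; apply: differentiable_continuous; exact/derivable1_diffP. Qed.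

Lemma le_of_derive_ge0 phi dphi a b : a <= b ->
  (forall x : R, is_derive x 1 phi (dphi x)) ->
  (forall x, a < x < b -> 0 <= dphi x) -> phi a <= phi b.
Proof.
rewrite le_eqVlt => /predU1P[->//|ab] d h.
have cphi : {within `[a, b], continuous phi}.
  apply: continuous_subspaceT; apply: derivable_continuous => x.
  by have /@ex_derive := d x.
have [c cab e] := MVT ab (fun x _ => d x) cphi.
rewrite -subr_ge0 e mulr_ge0 ?subr_ge0 ?(ltW ab)//.
by apply: h; rewrite in_itv in cab.
Qed.

(** All comparisons of f with its derivative below are obtained by comparing
the derivatives of two functions of the length of the increment. *)
Lemma increment_le (phi psi dphi dpsi : R -> R) a b : a <= b ->
  (forall x : R, is_derive x 1 phi (dphi x)) ->
  (forall x : R, is_derive x 1 psi (dpsi x)) ->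
  (forall x, a < x < b -> dphi x <= dpsi x) -> phi b - phi a <= psi b - psi a.
Proof.
move=> ab dp ds h.
have := @le_of_derive_ge0 (psi - phi) (dpsi - dphi) a b ab (fun x => is_deriveB _ _).
have /[swap]/[apply] : forall x, a < x < b -> 0 <= (dpsi - dphi) x.
  by move=> x /h; rewrite -subr_ge0.
rewrite -![(psi - phi) _]/(psi _ - phi _); lra.
Qed.

Lemma is_derive_linear (k t : R) : is_derive t 1 ( *%R k) k.
Proof.
apply: (is_derive_eq (is_deriveZ k (is_derive_id t 1))).
by rewrite /GRing.scale/= mulr1.
Qed.

(** The rules of differentiation with the functions written pointwise, the form in
which [increment_le] uses them. *)
Section pointwise.
Variables (phi psi : R -> R) (t u v k : R).
Hypotheses (hphi : is_derive t 1 phi u) (hpsi : is_derive t 1 psi v).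

Lemma is_derive_fun_add : is_derive t 1 (fun t => phi t + psi t) (u + v).
Proof. exact: is_deriveD. Qed.

Lemma is_derive_fun_sub : is_derive t 1 (fun t => phi t - psi t) (u - v).
Proof. exact: is_deriveB. Qed.

Lemma is_derive_fun_scale : is_derive t 1 (fun t => k * phi t) (k * u).
Proof. exact: is_deriveZ. Qed.

Lemma is_derive_fun_mul : is_derive t 1 (fun t => phi t * psi t) (phi t * v + psi t * u).
Proof. exact: is_deriveM. Qed.

End pointwise.

Lemma is_derive_affine_comp phi dphi (x k t : R) :
  (forall y : R, is_derive y 1 phi (dphi y)) ->
  is_derive t 1 (fun t => phi (x + k * t)) (dphi (x + k * t) * k).
Proof.
move=> h; apply: (@is_derive1_comp _ phi (fun t => x + k * t)).
apply: (is_derive_eq (is_deriveD (is_derive_cst x t 1) (is_derive_linear k t))).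
exact: add0r.
Qed.

(** The constant kappa is a supremum over open ranges of parameters; continuity
extends the resulting inequalities to the ends of these ranges. *)
Lemma ge_continuous_endpoints phi a b m : a < b -> continuous phi ->
  (forall x, a < x < b -> m <= phi x) -> m <= phi a /\ m <= phi b.
Proof.
move=> ab phic h; split.
  have cv : phi x @[x --> a^'+] --> phi a by exact/cvg_at_right_filter/phic.
  rewrite -(cvg_lim (@Rhausdorff R) cv); apply: limr_ge; first exact: cvgP cv.
  near=> x; apply: h; apply/andP; split; near: x.
    exact: nbhs_right_gt.
  exact: nbhs_right_lt.
have cv : phi x @[x --> b^'-] --> phi b by exact/cvg_at_left_filter/phic.
rewrite -(cvg_lim (@Rhausdorff R) cv); apply: limr_ge; first exact: cvgP cv.
near=> x; apply: h; apply/andP; split; near: x.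
  exact: nbhs_left_gt.
exact: nbhs_left_lt.
Unshelve. all: by end_near. Qed.

End mean_value.

(** * Functions whose derivative is nondecreasing and concave *)

Section F12_theory.
Context {R : realType} (f : R -> R).
Hypothesis fF : F12 f.
Implicit Types x y s d : R.
Local Notation df := (derive1 f).

Lemma F12_is_derive (x : R) : is_derive x 1 f (df x).
Proof.
by case: fF => -[d _] _ _ _ _; rewrite derive1E; exact: DeriveDef.
Qed.
#[local] Hint Resolve F12_is_derive : core.

Lemma F12_continuous : continuous f.
Proof. by case: fF => -[d _] _ _ _ _; exact: derivable_continuous. Qed.

Lemma F12_0 : f 0 = 0. Proof. by case: fF. Qed.

Lemma F12_even x : f (- x) = f x. Proof. by case: fF. Qed.

Lemma F12_norm x : f `|x| = f x.
Proof. by case: (ger0P x) => _ //; rewrite F12_even. Qed.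

Lemma F12_derive1N x : df (- x) = - df x.
Proof.
have h : is_derive (- x) 1 (f \o -%R) (df (- - x) * - 1).
  exact: is_derive1_comp.
have {h} := @derive_val _ _ _ _ _ _ _ h.
rewrite opprK mulrN1 (_ : f \o -%R = f) -?derive1E //.
by apply/funext => y; rewrite /= F12_even.
Qed.

Lemma F12_derive1_0 : df 0 = 0.
Proof. by have := F12_derive1N 0; rewrite oppr0; lra. Qed.

Let df_homo_nneg x y : 0 <= x -> x <= y -> df x <= df y.
Proof.
case: fF => _ _ _ h _ x0 xy; apply: h => //; rewrite in_itv /= andbT //.
exact: le_trans xy.
Qed.

Lemma F12_derive1_ge0 x : 0 <= x -> 0 <= df x.
Proof. by move=> x0; rewrite -F12_derive1_0 df_homo_nneg. Qed.

Lemma F12_derive1_homo : {homo df : x y / x <= y}.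
Proof.
move=> x y xy; have [x0|x0] := leP 0 x; first exact: df_homo_nneg.
have [y0|y0] := leP 0 y.
  rewrite (@le_trans _ _ 0) ?F12_derive1_ge0//.
  by rewrite -[x]opprK F12_derive1N oppr_le0 F12_derive1_ge0// oppr_ge0 ltW.
rewrite -[x]opprK -[y]opprK ![df (- - _)]F12_derive1N lerN2.
by apply: df_homo_nneg; lra.
Qed.

Lemma F12_derive1_concave (t x y : R) : 0 <= t <= 1 -> 0 <= x -> 0 <= y ->
  t * df x + (1 - t) * df y <= df (t * x + (1 - t) * y).
Proof.
move=> /andP[t0 t1] x0 y0; case: fF => _ _ _ _ h.
have ti : Itv.spec (@Itv.num_sem R) (Itv.Real `[0%Z, 1%Z]) t.
  by rewrite /= /Itv.num_sem/= num_real in_itv/= t0 t1.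
have := h (Itv.mk ti) x y.
rewrite !inE /= !in_itv /= !andbT => /(_ x0 y0).
rewrite !convRE /= !mulrN -opprD lerN2.
by apply: le_trans; rewrite /unstable.onem.
Qed.

(** A concave function that vanishes at 0 has nonincreasing slopes from the
origin. *)
Lemma F12_derive1_ratio x y : 0 <= x -> x <= y -> x * df y <= y * df x.
Proof.
move=> x0 xy; have [y0|y0] := leP y 0.
  have [-> ->] : x = 0 /\ y = 0 by lra.
  by rewrite !mul0r.
have t01 : 0 <= x / y <= 1 by rewrite divr_ge0 ?(ltW y0)// ler_pdivrMr// mul1r.
have := F12_derive1_concave t01 (ltW y0) (lexx 0).
rewrite F12_derive1_0 !mulr0 !addr0 divfK ?gt_eqF//.
by rewrite mulrAC ler_pdivrMr// [df x * y]mulrC.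
Qed.

Lemma F12_derive1_subadd x y : 0 <= x -> 0 <= y -> df (x + y) <= df x + df y.
Proof.
move=> x0 y0; have [z0|z0] := leP (x + y) 0.
  have [-> ->] : x = 0 /\ y = 0 by lra.
  by rewrite addr0 F12_derive1_0 addr0.
have h1 : x <= x + y by lra.
have h2 : y <= x + y by lra.
have := F12_derive1_ratio x0 h1; have := F12_derive1_ratio y0 h2.
by move=> h3 h4; rewrite -(ler_pM2l z0); lra.
Qed.

(** The derivative is nondecreasing on the whole line, being odd, so f is convex. *)
Lemma F12_tangent x y : f x + df x * (y - x) <= f y.
Proof.
have [xy|/ltW yx] := leP x y.
  have := increment_le xy (is_derive_linear (df x)) F12_is_derive.
  move=> /(_ (fun t tx => F12_derive1_homo (ltW (proj1 (andP tx))))); lra.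
have := increment_le yx F12_is_derive (is_derive_linear (df x)).
move=> /(_ (fun t tx => F12_derive1_homo (ltW (proj2 (andP tx))))); lra.
Qed.

Lemma F12_ge0 x : 0 <= f x.
Proof.
by have := F12_tangent 0 x; rewrite F12_0 F12_derive1_0 mul0r addr0.
Qed.

Lemma F12_homo x y : 0 <= x -> x <= y -> f x <= f y.
Proof.
move=> x0 xy; have := F12_tangent x y.
have := F12_derive1_ge0 x0; nra.
Qed.

Lemma F12_ratio x y : 0 <= x -> x <= y -> y * f x <= x * f y.
Proof.
move=> x0 xy; have := F12_tangent x y; have := F12_tangent x 0.
rewrite F12_0; nra.
Qed.

Lemma F12_increment_le x d : 0 <= x -> 0 <= d -> f (x + d) - f x - d * df x <= f d.
Proof.
move=> x0 d0.
have := increment_le d0 (fun t => is_derive_affine_comp x 1 t F12_is_derive)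
  (fun t => is_derive_fun_add (F12_is_derive t) (is_derive_linear (df x) t)).
rewrite /= !mulr0 !addr0 !mul1r F12_0 subr0 => h.
suff : f (x + d) - f x <= f d + df x * d by lra.
apply: h => t /andP[t0 _]; rewrite mul1r mulr1 addrC.
by apply: F12_derive1_subadd => //; exact: ltW.
Qed.

Lemma F12_decrement_le x s : 0 <= s -> s <= x -> f (x - s) - f x + s * df x <= f s.
Proof.
move=> s0 sx.
have := increment_le s0 (fun t => is_derive_affine_comp x (-1) t F12_is_derive)
  (fun t => is_derive_fun_sub (F12_is_derive t) (is_derive_linear (df x) t)).
rewrite /= !mulr0 !addr0 !mulN1r F12_0 !subr0 => h.
suff : f (x - s) - f x <= f s - df x * s by lra.
apply: h => t /andP[t0 ts]; rewrite mulN1r mulrN1.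
have := @F12_derive1_subadd (x - t) t; rewrite subrK => H.
have := H ltac:(lra) ltac:(lra); lra.
Qed.

(** The derivative at x is at least the mean of the derivatives at x + t and x - t,
by concavity; integrate over t in [0, x]. *)
Lemma F12_doubling x : 0 <= x -> f (2 * x) <= 2 * x * df x.
Proof.
move=> x0.
have := increment_le x0 (fun t => is_derive_fun_sub (is_derive_affine_comp x 1 t F12_is_derive)
  (is_derive_affine_comp x (-1) t F12_is_derive))
  (fun t => is_derive_linear (2 * df x) t).
rewrite /= !mulr0 !addr0 !mul1r !mulN1r !subrr F12_0 !subr0 => h.
suff : f (x + x) <= 2 * df x * x by rewrite [2 * x]mulr_natl mulr2n; lra.
apply: h => t /andP[t0 ts]; rewrite mulN1r mulrN1 mulr1 mul1r opprK.
have h01 : 0 <= (2^-1 : R) <= 1 by lra.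
have := @F12_derive1_concave 2^-1 (x + t) (x - t) h01 ltac:(lra) ltac:(lra).
rewrite (_ : 2^-1 * (x + t) + (1 - 2^-1) * (x - t) = x); last by field.
by lra.
Qed.

(** By concavity t f'(s) <= s f'(t) for t <= s; integrate over t in [0, s]. *)
Lemma F12_derive1_le s : 0 <= s -> s * df s <= 2 * f s.
Proof.
move=> s0; have [/eqP ->|sn0] := boolP (s == 0); first by rewrite F12_0 mul0r mulr0.
have sgt : 0 < s by rewrite lt_neqAle eq_sym sn0.
have := increment_le s0
  (fun t => is_derive_fun_scale (df s) (is_derive_fun_mul (is_derive_id t 1) (is_derive_id t 1)))
  (fun t => is_derive_fun_scale (2 * s) (F12_is_derive t)).
rewrite !mulr0 F12_0 mulr0 !subr0 => h.
have : df s * (s * s) <= 2 * s * f s.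
  apply: h => t /andP[t0 ts]; have := @F12_derive1_ratio t s (ltW t0) (ltW ts); lra.
by move=> H; rewrite -(ler_pM2l sgt); lra.
Qed.

Hypothesis f_neq0 : f <> cst 0.

(** If f vanishes at some x > 0 then f' vanishes at x / 2 by convexity, hence on
[0, x / 2] by monotonicity and beyond x / 2 by concavity. *)
Lemma F12_gt0 x : x != 0 -> 0 < f x.
Proof.
move=> xn0; rewrite lt_neqAle F12_ge0 andbT eq_sym; apply/negP => /eqP fx0.
apply: f_neq0; apply/funext => y /=.
wlog x0 : x xn0 fx0 / 0 < x.
  move=> h; have [|] := ltP 0 x; first exact: h.
  by move=> x0; apply: (h (- x)); rewrite ?oppr_eq0 ?F12_even// oppr_gt0 lt_neqAle xn0.
rewrite -F12_norm; apply/le_anti; rewrite F12_ge0 andbT.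
have dfx0 : df (x / 2) <= 0.
  have := F12_tangent (x / 2) x; rewrite fx0.
  have := F12_ge0 (x / 2) => h1 h2; rewrite -(@pmulr_rle0 _ (x / 2)); lra.
have dfy z : 0 <= z -> df z <= 0.
  move=> z0; have [zx|/ltW xz] := leP z (x / 2).
    by apply: le_trans dfx0; exact: F12_derive1_homo.
  have := @F12_derive1_ratio (x/2) z ltac:(lra) xz.
  move=> h; rewrite -(@pmulr_rle0 _ (x / 2)); last by lra.
  by apply: le_trans h _; rewrite mulr_ge0_le0.
have := F12_tangent `|y| 0; rewrite F12_0 sub0r mulrN.
have := dfy `|y| (normr_ge0 _); have := normr_ge0 y; nra.
Qed.

(** The quotient in the definition of C_f is already at least 1 at x = 1, s = 2,
by [F12_doubling]. *)
Lemma C_const_ge1 : (1 <= C_const f)%E.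
Proof.
apply: (@le_trans _ _ ((f (1 - 2) - f 1 + 2 * df 1) / f 2)%:E); last first.
  by apply: ereal_sup_ubound; exists 1, 2; split=> //; lra.
rewrite lee_fin (_ : 1 - 2 = - 1); last by lra.
rewrite F12_even ler_pdivlMr ?F12_gt0// mul1r.
by have := @F12_doubling 1 ler01; rewrite mulr1; lra.
Qed.

Lemma C_const_le3 : (C_const f <= 3%:E)%E.
Proof.
apply: ge_ereal_sup => _ [x [s [/andP[x0 xs] ->]]].
have fs : 0 < f s by apply: F12_gt0; lra.
rewrite lee_fin ler_pdivrMr// -F12_even opprB.
have := @F12_homo (s - x) s ltac:(lra) ltac:(lra).
have := F12_ge0 x; have := @F12_derive1_le s ltac:(lra).
have : s * df x <= s * df s.
  by rewrite ler_pM2l ?(lt_trans x0)//; apply: F12_derive1_homo; exact: ltW.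
lra.
Qed.

Lemma C_const_fin_num : C_const f \is a fin_num.
Proof.
rewrite fin_numElt (lt_le_trans (ltNyr 1) C_const_ge1).
exact: le_lt_trans C_const_le3 (ltry _).
Qed.

(** The definition of C_f is this inequality for 0 < x < - d. *)
Lemma F12_taylor_le x d : f (x + d) - f x - d * df x <= fine (C_const f) * f d.
Proof.
have C1 : 1 <= fine (C_const f) by rewrite -lee_fin fineK ?C_const_ge1 ?C_const_fin_num.
have lefd z : z <= f d -> z <= fine (C_const f) * f d.
  by move/le_trans; apply; rewrite ler_peMl ?F12_ge0.
wlog x0 : x d lefd / 0 <= x.
  move=> h; have [|x0] := leP 0 x; first exact: h.
  have := h (- x) (- d).
  rewrite -opprD !F12_even F12_derive1N mulrNN.
  by apply=> //; rewrite oppr_ge0 ltW.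
have [d0|d0] := leP 0 d; first by apply: lefd; exact: F12_increment_le.
have [sx|xs] := leP (- d) x.
  apply: lefd; rewrite -[f d]F12_even.
  by have := @F12_decrement_le x (- d) ltac:(lra) sx; rewrite opprK; lra.
have [/eqP ->|xn0] := boolP (x == 0).
  by apply: lefd; rewrite add0r F12_0 F12_derive1_0; lra.
have xgt0 : 0 < x by rewrite lt_neqAle eq_sym xn0.
rewrite -[f d]F12_even -ler_pdivrMr; last by apply: F12_gt0; lra.
rewrite -lee_fin fineK ?C_const_fin_num//.
apply: ereal_sup_ubound; exists x, (- d); split; first by rewrite xgt0.
by rewrite opprK mulNr.
Qed.

(** U f c s a is s times Ef(Z + a) when Z takes the values s - c and - c with
probabilities c / s and (s - c) / s, so that Z has mean 0. *)
Lemma U0E c s : U f c s 0 = c * f (s - c) + (s - c) * f c.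
Proof. by rewrite /U addr0 sub0r F12_even. Qed.

Lemma U_gt0 c s a : 0 < s -> 0 < c < s / 2 -> 0 < a < c -> 0 < U f c s a.
Proof.
move=> s0 /andP[c0 cs] /andP[a0 ac].
by rewrite /U addr_gt0// mulr_gt0 ?F12_gt0//; lra.
Qed.

(** With b = s - c >= c, the ratio f(x) / x being nondecreasing gives
b f(c) <= c f(b), so U(c, s, 0) <= 2 c f(b), and c f(b) <= c f(b + a). *)
Lemma kappa_le2 : (kappa f <= 2%:E)%E.
Proof.
apply: ge_ereal_sup => _ [s [c [a [s0 cs ac ->]]]].
rewrite lee_fin ler_pdivrMr ?U_gt0// U0E /U.
move: cs ac => /andP[c0 cs] /andP[a0 ac].
have := @F12_ratio c (s - c) ltac:(lra) ltac:(lra).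
have h1 : c * f (s - c) <= c * f (s - c + a).
  by rewrite ler_pM2l//; apply: F12_homo; lra.
have h2 : 0 <= (s - c) * f (a - c) by rewrite mulr_ge0 ?F12_ge0//; lra.
lra.
Qed.

Lemma U_continuous c s : continuous (U f c s).
Proof.
move=> a; rewrite /U; apply: cvgD; apply: cvgMr; last first.
  apply: continuous_comp; first by apply: cvgB; [exact: cvg_id|exact: cvg_cst].
  exact: F12_continuous.
apply: (@continuous_comp _ _ _ (fun a => s - c + a) f).
  by apply: cvgD; [exact: cvg_cst|exact: cvg_id].
exact: F12_continuous.
Qed.

Lemma U_le_ubound (k : R) : (kappa f <= k%:E)%E ->
  forall c s a, 0 < s -> 0 < c < s / 2 -> 0 < a < c -> U f c s 0 <= k * U f c s a.
Proof.
move=> fk c s a s0 cs ac; rewrite -ler_pdivrMr ?U_gt0// -lee_fin.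
by apply: le_trans fk; apply: ereal_sup_ubound; exists s, c, a.
Qed.

(** The ratio tends to 1 as a tends to 0; it can be smaller than 1 for every
admissible a, as for the square function. *)
Lemma kappa_ge1 : (1 <= kappa f)%E.
Proof.
rewrite leNgt; apply/negP => k1.
have k0 : (0 <= kappa f)%E.
  apply: (@le_trans _ _ (U f 1 4 0 / U f 1 4 2^-1)%:E).
    rewrite lee_fin divr_ge0// ?U0E.
      by rewrite addr_ge0 ?mulr_ge0 ?F12_ge0//; lra.
    by apply/ltW/U_gt0; lra.
  by apply: ereal_sup_ubound; exists 4, 1, 2^-1; split=> //; lra.
have kfin : kappa f \is a fin_num by rewrite ge0_fin_numE ?(lt_trans k1) ?ltry.
have Ule := @U_le_ubound (fine (kappa f)); rewrite fineK// in Ule.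
have {}Ule := Ule (lexx _) 1 4.
have U0 : 0 < U f 1 4 0 by rewrite U0E addr_gt0// mulr_gt0// ?F12_gt0//; lra.
(* If kappa < 1, let a tend to 0 in U(1, 4, 0) <= kappa U(1, 4, a). *)
have [] := @ge_continuous_endpoints _ (fun a => fine (kappa f) * U f 1 4 a) 0 1
    (U f 1 4 0) ltr01 _ (fun a a01 => Ule a ltac:(lra) ltac:(lra) a01).
  by move=> a; apply: cvgMr; exact: U_continuous.
move=> + _; rewrite -subr_ge0 -{2}[U _ _ _ _]mul1r -mulrBl pmulr_lge0// subr_ge0.
by rewrite -lee_fin fineK// leNgt k1.
Qed.

Lemma kappa_fin_num : kappa f \is a fin_num.
Proof.
rewrite fin_numElt (lt_le_trans (ltNyr 1) kappa_ge1).
exact: le_lt_trans kappa_le2 (ltry _).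
Qed.

Lemma fine_kappa_ge1 : 1 <= fine (kappa f).
Proof. by rewrite -lee_fin fineK ?kappa_ge1 ?kappa_fin_num. Qed.

(** Extension of the inequality that defines kappa to all the mean-zero two-point
laws and all shifts a.  Exchanging the two atoms gives c <= s / 2.  For a <= 0
and for c = s / 2, convexity gives U(c, s, 0) <= U(c, s, a); for a >= c, both
terms of U(c, s, a) increase with a. *)
Lemma U_le_kappa c s a : 0 < c < s -> U f c s 0 <= fine (kappa f) * U f c s a.
Proof.
move=> /andP[c0 cs].
have k1 := fine_kappa_ge1.
have kU c' s' a' := @U_le_ubound (fine (kappa f)) ltac:(by rewrite fineK ?kappa_fin_num) c' s' a'.
have Uge0 a' c' : 0 < c' < s -> 0 <= U f c' s a'.
  by move=> c's; rewrite /U addr_ge0// mulr_ge0 ?F12_ge0//; lra.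
have le_kU a' c' : 0 < c' < s -> U f c' s 0 <= U f c' s a' ->
    U f c' s 0 <= fine (kappa f) * U f c' s a'.
  by move=> c's /le_trans; apply; rewrite ler_peMl ?Uge0.
(* Reflection exchanges the two atoms and changes the sign of the shift. *)
wlog cs2 : c a c0 cs / c <= s / 2.
  move=> h; have [|c2s] := leP c (s / 2); first exact: h.
  have := h (s - c) (- a) ltac:(lra) ltac:(lra) ltac:(lra).
  have Usym a' : U f (s - c) s (- a') = U f c s a'.
    rewrite /U (_ : s - (s - c) + - a' = - (a' - c)); last by lra.
    rewrite (_ : - a' - (s - c) = - (s - c + a')); last by lra.
    by rewrite !F12_even; lra.
  by rewrite Usym -{1}oppr0 Usym.
have ccs : 0 < c < s by lra.
have [a0|a0] := leP a 0.
  (* To the left of 0, U is above its tangent at 0, whose slope is nonpositive. *)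
  apply: le_kU => //; rewrite U0E /U.
  have h1 := F12_tangent (s - c) (s - c + a).
  have h2 := F12_tangent (- c) (a - c).
  rewrite F12_even F12_derive1N in h2.
  have h3 : c * df (s - c) <= (s - c) * df c by apply: F12_derive1_ratio; lra.
  have : c * (f (s - c) + df (s - c) * (s - c + a - (s - c))) <= c * f (s - c + a).
    by rewrite ler_pM2l.
  have : (s - c) * (f c + - df c * (a - c - - c)) <= (s - c) * f (a - c).
    by rewrite ler_pM2l//; lra.
  have : 0 <= - a * ((s - c) * df c - c * df (s - c)).
    by rewrite mulr_ge0//; lra.
  lra.
have [c2|cn2] := eqVneq c (s / 2).
  apply: le_kU => //; rewrite U0E /U.
  have -> : s - c = c by lra.
  have h1 := F12_tangent c (c + a).
  have h2 := F12_tangent (- c) (a - c); rewrite F12_even F12_derive1N in h2.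
  by rewrite -!mulrDr ler_pM2l//; lra.
have c0s2 : 0 < c < s / 2 by rewrite c0 lt_neqAle cn2.
have s0 : 0 < s by lra.
have [ac|ca] := ltP a c; first by apply: kU => //; rewrite a0.
(* For a >= c, compare with the value at a = c, a limit of admissible shifts. *)
have [] := @ge_continuous_endpoints _ (fun a => fine (kappa f) * U f c s a) 0 c
    (U f c s 0) c0 _ (fun a a0c => kU c s a s0 c0s2 a0c).
  by move=> a'; apply: cvgMr; exact: U_continuous.
move=> _ /le_trans; apply; rewrite ler_pM2l ?(lt_le_trans ltr01)//.
rewrite /U subrK subrr F12_0 mulr0 addr0.
have : c * f s <= c * f (s - c + a) by rewrite ler_pM2l//; apply: F12_homo; lra.
have : 0 <= (s - c) * f (a - c) by rewrite mulr_ge0 ?F12_ge0//; lra.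
lra.
Qed.

(** With phi(z) = kappa f(z + a) - f(z), the two-point inequality says that
- phi(- v) / v <= phi(u) / u for all u, v > 0.  A number l between the two
families is a slope such that phi(z) >= l z for all z, so integrating against
any mean-zero law gives Ef(Z) <= kappa Ef(Z + a). *)
Lemma recentering_supporting_line a :
  exists l : R, forall z, f z <= fine (kappa f) * f (z + a) + l * z.
Proof.
pose k := fine (kappa f).
have key u v : 0 < u -> 0 < v ->
    (f v - k * f (a - v)) / v <= (k * f (a + u) - f u) / u.
  move=> u0 v0; rewrite ler_pdivrMr// mulrAC ler_pdivlMr//.
  have := @U_le_kappa v (u + v) a ltac:(lra).
  rewrite U0E /U (_ : u + v - v = u); last by lra.
  by rewrite [u + a]addrC -/k; lra.
pose S := [set (f v - k * f (a - v)) / v | v in [set v : R | 0 < v]].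
have S0 : S !=set0 by exists ((f 1 - k * f (a - 1)) / 1); exists 1 => //=.
have Sub u : 0 < u -> ubound S ((k * f (a + u) - f u) / u).
  by move=> u0 _ [v v0 <-]; exact: key.
exists (- sup S) => z; rewrite [z + a]addrC -/k.
have [z0|z0|->] := ltgtP z 0.
- have : (f (- z) - k * f (a + z)) / (- z) <= sup S.
    apply: ub_le_sup; first by eexists; exact: (Sub 1).
    by exists (- z); rewrite ?opprK//= oppr_gt0.
  rewrite F12_even ler_pdivrMr; last by lra.
  lra.
- have : sup S <= (k * f (a + z) - f z) / z by apply: ge_sup => //; exact: Sub.
  by rewrite ler_pdivlMr//; lra.
- by rewrite mulr0 !addr0 F12_0 mulr_ge0 ?F12_ge0// (le_trans ler01 fine_kappa_ge1).
Qed.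

End F12_theory.

(** * Resampling one coordinate of an independent family *)

Section product_sigma_algebra.
Context {I : finType} {d : I -> measure_display} {T : forall i, measurableType (d i)}.

Lemma measurable_coord (i : I) : measurable_fun setT (fun x : prodT T => x i).
Proof.
move=> _ B mB; apply: sub_sigma_algebra; exists i => //.
by exists B.
Qed.

Lemma measurable_fun_prodT {dS} {S : measurableType dS} (F : S -> prodT T) :
  (forall i, measurable_fun setT (fun s => F s i)) -> measurable_fun setT F.
Proof.
move=> mF; apply: (@measurability _ _ S (prodT T) setT F (@cylinders I d T) erefl).
move=> _ [_ [i _ [B mB <-]] <-].
rewrite !setTI; have := mF i measurableT B mB; by rewrite setTI.
Qed.

Lemma measurable_dfwith (k : I) :
  measurable_fun setT (fun z : prodT T * T k => dfwith z.1 k z.2 : prodT T).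
Proof.
apply: measurable_fun_prodT => i; have [<-|ki] := eqVneq k i.
  apply: (eq_measurable_fun snd); last exact: measurable_snd.
  by move=> z _ /=; rewrite dfwithin.
apply: (eq_measurable_fun ((fun x : prodT T => x i) \o fst)).
  by move=> z _ /=; rewrite dfwithout.
by apply: measurableT_comp; [exact: measurable_coord|exact: measurable_fst].
Qed.

Definition rectangle (A : forall i, set (T i)) : set (prodT T) :=
  [set x | forall i, A i (x i)].

Definition rectangles : set (set (prodT T)) :=
  [set rectangle A | A in [set A | forall i, measurable (A i)]].

Lemma setI_closed_rectangles : setI_closed rectangles.
Proof.
move=> _ _ [A mA <-] [B mB <-]; exists (fun i => A i `&` B i).
  by move=> i; apply: measurableI; [exact: mA|exact: mB].
apply/seteqP; split=> [x h|x [h1 h2] i]; last by split.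
by split=> i; have [] := h i.
Qed.

Lemma measurable_rectangle (A : forall i, set (T i)) :
  (forall i, measurable (A i)) -> measurable (rectangle A).
Proof.
move=> mA.
have -> : rectangle A = \bigcap_(i in [set: I]) ((fun x : prodT T => x i) @^-1` A i).
  by apply/seteqP; split => [x h i _|x h i]; [exact: h|exact: (h i)].
apply: fin_bigcap_measurable => // i _.
by rewrite -[_ @^-1` _]setTI; exact: measurable_coord.
Qed.

(** Unlike the cylinders over a single coordinate, the rectangles are stable under
intersection, so they determine a probability. *)
Lemma measurable_prodTE : @measurable _ (prodT T) = <<s rectangles >>.
Proof.
apply/seteqP; split.
  apply: smallest_sub; first exact: smallest_sigma_algebra.
  move=> _ [i _ [B mB <-]]; apply: sub_sigma_algebra.
  exists (dfwith (fun j => setT) i B).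
    by move=> j /=; case: dfwithP => // j' _; exact: measurableT.
  rewrite setTI; apply/seteqP; split => [x /= /(_ i)|x /= xB j].
    by rewrite dfwithin.
  by case: dfwithP.
apply: smallest_sub; first exact: sigma_algebra_measurable.
by move=> _ [A mA <-]; exact: measurable_rectangle.
Qed.

End product_sigma_algebra.

Section resampling.
Context {I : finType} {d : I -> measure_display} {T : forall i, measurableType (d i)}.
Context {dO} {Omega : measurableType dO} {R : realType} (P : probability Omega R).
Variable X : forall i, {RV P >-> T i}.
Hypothesis indep : mutually_independent P X.

Definition joint (w : Omega) : prodT T := fun i => X i w.

Lemma measurable_joint : measurable_fun setT joint.
Proof. by apply: measurable_fun_prodT => i; exact: measurable_funPT. Qed.

(** The family X with its k-th coordinate replaced by a point drawn independently
of all of X. *)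
Definition resample k (z : Omega * T k) : prodT T := dfwith (joint z.1) k z.2.

Lemma measurable_resample k : measurable_fun setT (@resample k).
Proof.
have -> : @resample k =
  (fun z : prodT T * T k => dfwith z.1 k z.2 : prodT T) \o (fun z => (joint z.1, z.2)).
  by [].
apply: measurableT_comp; first exact: measurable_dfwith.
apply/measurable_fun_pairP; split.
  exact: (measurableT_comp measurable_joint measurable_fst).
exact: measurable_snd.
Qed.

Let law k : probability (T k) R := distribution P (X k).

(** By independence, both laws give a rectangle the product of the probabilities of
its sides. *)
Lemma pushforward_resample k (E : set (prodT T)) : measurable E ->
  pushforward P joint E = pushforward (P \x (law k))%E (@resample k) E.
Proof.
move=> mE.
apply: (@measure_unique _ R (prodT T) rectangles (fun=> setT) measurable_prodTE
  setI_closed_rectangles _ _ _ _ _ _ E mE).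
- by move=> _; exists (fun=> setT) => [i|]; [exact: measurableT|exact/seteqP].
- by rewrite bigcup_const//; exists 0%N.
- exact: measurable_joint.
- exact: measurable_resample.
- move=> mj mr ? [A mA <-]; rewrite /= /pushforward.
  have -> : joint @^-1` rectangle A = \bigcap_(i in [set` [set: I]%SET]) (X i @^-1` A i).
    apply/seteqP; split => [w h i _|w h i]; first exact: h.
    by apply: (h i); rewrite /= inE.
  have -> : @resample k @^-1` rectangle A =
      (\bigcap_(i in [set` [set~ k]%SET]) (X i @^-1` A i)) `*` A k.
    apply/seteqP; split => [[w y] h|[w y] [h1 h2] i] /=.
      split=> [i /=|]; last by have := h k; rewrite /resample dfwithin.
      rewrite !inE => ik; have := h i; rewrite /resample dfwithout//.
      by rewrite eq_sym.
    rewrite /resample /=; case: dfwithP => // j kj.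
    by apply: (h1 j); rewrite /= !inE eq_sym.
  have mX i : measurable (X i @^-1` A i).
    by rewrite -[_ @^-1` _]setTI; exact: measurable_funPT.
  rewrite product_measure1E; [|exact: fin_bigcap_measurable|exact: mA].
  rewrite !indep// (bigD1 k)//= muleC; congr (_ * _)%E.
  apply: etrans; last by apply/esym; exact: indep.
  by apply: eq_bigl => i; rewrite !inE.
- by move=> mj _; rewrite /= /pushforward preimage_setT probability_setT ltry.
Qed.

Lemma integral_resample (k : I) (phi : prodT T -> \bar R) :
  measurable_fun [set: prodT T] phi -> (forall x, 0 <= phi x)%E ->
  (\int[P]_w phi (joint w) =
   \int[P]_w \int[law k]_y phi (dfwith (joint w) k y))%E.
Proof.
move=> mphi phi0.
transitivity (\int[(P \x (law k))%E]_z phi (resample z))%E; last first.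
  rewrite fubini_tonelli1//.
  exact: (measurableT_comp mphi (@measurable_resample k)).
rewrite -[LHS](@ge0_integral_pushforward _ _ _ _ R _ measurable_joint P setT phi)//.
rewrite -[RHS](@ge0_integral_pushforward _ _ _ _ R _ (@measurable_resample k)
  (P \x (law k))%E setT phi)//.
apply: eq_measure_integral; [exact: measurable_resample|exact: measurable_joint|].
by move=> mr mj E mE _; exact: pushforward_resample.
Qed.

Lemma integrable_resample (k : I) (g : prodT T -> R) :
  measurable_fun setT g -> P.-integrable setT (EFin \o g \o joint) ->
  (P \x (law k))%E.-integrable setT (EFin \o g \o @resample k).
Proof.
move=> mg /integrableP[_ ig]; apply/integrableP; split.
  apply/measurable_EFinP.
  exact: (measurableT_comp mg (@measurable_resample k)).
rewrite fubini_tonelli1//; last first.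
  apply: measurableT_comp => //; apply/measurable_EFinP.
  exact: (measurableT_comp mg (@measurable_resample k)).
apply: le_lt_trans ig; rewrite le_eqVlt; apply/orP; left; apply/eqP/esym.
apply: (@integral_resample k (fun x => `|(g x)%:E|%E)) => //.
by apply: measurableT_comp => //; exact/measurable_EFinP.
Qed.

Lemma integral_resample_integrable (k : I) (g : prodT T -> R) :
  measurable_fun setT g -> P.-integrable setT (EFin \o g \o joint) ->
  (\int[P]_w (g (joint w))%:E =
   \int[P]_w \int[law k]_y (g (dfwith (joint w) k y))%:E)%E.
Proof.
move=> mg ig.
transitivity (\int[(P \x (law k))%E]_z (g (resample z))%:E)%E; last first.
  by rewrite -(integral12_prod_meas1 (integrable_resample k mg ig)).
have mg' : measurable_fun [set: prodT T] (EFin \o g) by exact/measurable_EFinP.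
rewrite -[LHS](@integral_pushforward _ _ _ _ R _ measurable_joint P setT (EFin \o g))//.
rewrite -[RHS](@integral_pushforward _ _ _ _ R _ (@measurable_resample k)
  (P \x (law k))%E setT (EFin \o g))//; last exact: integrable_resample.
apply: eq_measure_integral; [exact: measurable_resample|exact: measurable_joint|].
by move=> mr mj E mE _; exact: pushforward_resample.
Qed.

End resampling.

(** * The inequality for one random variable *)

Section one_variable.
Context {R : realType} (f : R -> R).
Hypotheses (fF : F12 f) (f_neq0 : f <> cst 0).

(** The product of the two constants as a real number; both are finite, so it can
be used in pointwise inequalities. *)
Definition moment_const : R := fine (kappa f) * fine (C_const f).

Lemma moment_const_gt0 : 0 < moment_const.
Proof.
rewrite mulr_gt0// (lt_le_trans ltr01)// -lee_fin fineK.
- exact: kappa_ge1.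
- exact: kappa_fin_num.
- exact: C_const_ge1.
- exact: C_const_fin_num.
Qed.

(** The Taylor bound at m, followed by the recentering bound with shift m - e0.
Both linear terms are multiples of t - m. *)
Lemma F12_centering_le (m e0 : R) : exists l : R, forall t,
  f t <= f m + moment_const * f (t - e0) + l * (t - m).
Proof.
have [l hl] := recentering_supporting_line fF f_neq0 (m - e0).
exists (derive1 f m + fine (C_const f) * l) => t.
have C0 : 0 <= fine (C_const f).
  by rewrite (le_trans ler01)// -lee_fin fineK ?C_const_ge1// C_const_fin_num.
have := F12_taylor_le fF f_neq0 m (t - m); rewrite [m + _]addrC subrK.
have := ler_wpM2l C0 (hl (t - m)); rewrite addrA subrK /moment_const.
lra.
Qed.

Lemma F12_mean_le {d} {S : measurableType d} (Q : probability S R)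
    (eta h : S -> R) (e0 : R) :
  Q.-integrable setT (EFin \o eta) -> (forall y, `|eta y - e0| <= h y) ->
  Q.-integrable setT (EFin \o f \o h) ->
  (\int[Q]_y (f (eta y))%:E <=
   (f (\int[Q]_y eta y)%R)%:E + moment_const%:E * \int[Q]_y (f (h y))%:E)%E.
Proof.
move=> ieta etah ifh; set m := (\int[Q]_y eta y)%R.
have [l hl] := F12_centering_le m e0.
have meta : measurable_fun setT eta.
  by apply/measurable_EFinP; exact: measurable_int ieta.
have mf : measurable_fun setT f by apply: continuous_measurable_fun; exact: F12_continuous.
pose c := f m - l * m.
have ic : Q.-integrable setT (EFin \o cst c) by exact: finite_measure_integrable_cst.
have iZ (k : R) (phi : S -> R) : Q.-integrable setT (EFin \o phi) ->
    Q.-integrable setT (EFin \o (fun y => k * phi y)).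
  by move=> /(integrableZl measurableT k).
have iD (phi psi : S -> R) : Q.-integrable setT (EFin \o phi) ->
    Q.-integrable setT (EFin \o psi) -> Q.-integrable setT (EFin \o (fun y => phi y + psi y)).
  by move=> i1 i2; exact: (integrableD measurableT i1 i2).
have iB := iD _ _ (iD _ _ ic (iZ l _ ieta)) (iZ moment_const (f \o h) ifh).
apply: (@le_trans _ _ (\int[Q]_y (c + l * eta y + moment_const * f (h y))%:E)%E).
  (* The majorant is written c + l eta + moment_const (f o h), with c = f m - l m, to
     integrate it term by term. *)
  apply: ge0_le_integral => //.
  - by move=> y _; rewrite lee_fin F12_ge0.
  - by apply/measurable_EFinP; exact: measurableT_comp.
  - exact: measurable_int iB.
  - move=> y _; rewrite lee_fin; apply: le_trans (hl (eta y)) _.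
    have : f (eta y - e0) <= f (h y) by rewrite -F12_norm//; exact: F12_homo.
    by move=> /(ler_wpM2l (ltW moment_const_gt0)); rewrite /c; lra.
have fm : (\int[Q]_y (eta y)%:E = m%:E)%E.
  by rewrite /m /Rintegral fineK//; exact: integrable_fin_num.
rewrite (integralD measurableT (iD _ _ ic (iZ l _ ieta)) (iZ moment_const (f \o h) ifh)).
rewrite (integralD measurableT ic (iZ l _ ieta)).
have -> : (\int[Q]_x (EFin \o cst c) x)%E = c%:E.
  by rewrite -[RHS]mule1 -(probability_setT Q); exact: (integral_cst Q measurableT c%:E).
rewrite (integralZl measurableT ieta l) fm (integralZl measurableT ifh moment_const).
by rewrite -EFinM -EFinD /c subrK.
Qed.

End one_variable.

(** * Integrating out the coordinates *)

Section integrate_out.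
Context {I : finType} {d : I -> measure_display} {T : forall i, measurableType (d i)}.
Context {R : realType} (mu : forall i, probability (T i) R).

Lemma dfwith_dfwith (x : forall i, T i) k (y z : T k) :
  dfwith (dfwith x k y) k z = dfwith x k z.
Proof.
apply: functional_extensionality_dep => i.
have [<-|ki] := eqVneq k i; first by rewrite !dfwithin.
by rewrite !dfwithout.
Qed.

Lemma dfwithC (x : forall i, T i) i k (y : T i) (z : T k) : i != k ->
  dfwith (dfwith x i y) k z = dfwith (dfwith x k z) i y.
Proof.
move=> ik; apply: functional_extensionality_dep => j.
have [<-|kj] := eqVneq k j; first by rewrite dfwithin dfwithout// dfwithin.
rewrite dfwithout//; have [<-|ij] := eqVneq i j; first by rewrite !dfwithin.
by rewrite !dfwithout.
Qed.

Definition integrate_out (k : I) (g : prodT T -> R) (x : prodT T) : R :=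
  \int[mu k]_y g (dfwith x k y).

Definition independent_of (i : I) (g : prodT T -> R) :=
  forall (x : prodT T) (y : T i), g (dfwith x i y) = g x.

Lemma independent_of_integrate_out k g : independent_of k (integrate_out k g).
Proof.
by move=> x y; apply: eq_Rintegral => z _; rewrite dfwith_dfwith.
Qed.

Lemma independent_of_integrate_outW i k g :
  independent_of i g -> independent_of i (integrate_out k g).
Proof.
have [<-|ik] := eqVneq i k; first by move=> _; exact: independent_of_integrate_out.
by move=> gi x y; apply: eq_Rintegral => z _; rewrite dfwithC.
Qed.

Variables (x0 : forall i, T i) (h : forall i, T i -> R).
Arguments h : clear implicits.

(** The consequence of the separate Lipschitz property that survives integration
over a coordinate: only the changes to the fixed reference point x0 i are
controlled, by a function of the new value alone. *)
Definition oscillation_le (g : prodT T -> R) :=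
  forall (i : I) (x : prodT T) (y : T i),
    `|g (dfwith x i y) - g (dfwith x i (x0 i))| <= h i y.

Hypothesis ih : forall i, (mu i).-integrable setT (EFin \o h i).

Lemma measurable_section (g : prodT T -> R) k x : measurable_fun setT g ->
  measurable_fun setT (fun y : T k => g (dfwith x k y)).
Proof.
move=> mg; apply: (measurableT_comp mg).
apply: (@measurableT_comp _ _ _ _ _ _ _ setT (fun y : T k => (x : prodT T, y))
  (@measurable_dfwith _ _ T k)).
exact: pair1_measurable.
Qed.

Lemma integrable_section (g : prodT T -> R) k x :
  measurable_fun setT g -> oscillation_le g ->
  (mu k).-integrable setT (fun y => (g (dfwith x k y))%:E).
Proof.
move=> mg og; pose c := `|g (dfwith x k (x0 k))|.
have ic : (mu k).-integrable setT (EFin \o cst c) by exact: finite_measure_integrable_cst.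
apply: (le_integrable measurableT _ _ (integrableD measurableT ic (ih k))).
  by apply/measurable_EFinP; exact: measurable_section.
move=> y _ /=; rewrite lee_fin.
apply: (@le_trans _ _ (c + h k y)); last exact: ler_norm.
have := og k x y; rewrite /c.
have := ler_normD (g (dfwith x k y) - g (dfwith x k (x0 k))) (g (dfwith x k (x0 k))).
by rewrite subrK; lra.
Qed.

Lemma EFin_integrate_out (g : prodT T -> R) k x :
  measurable_fun setT g -> oscillation_le g ->
  (integrate_out k g x)%:E = (\int[mu k]_y (g (dfwith x k y))%:E)%E.
Proof.
move=> mg og; rewrite /integrate_out /Rintegral fineK//.
by apply: integrable_fin_num => //; exact: integrable_section.
Qed.

(** The integral is a difference of two integrals of nonnegative functions, which
depend measurably on x by Tonelli. *)
Lemma measurable_integrate_out k (g : prodT T -> R) :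
  measurable_fun setT g -> measurable_fun setT (integrate_out k g).
Proof.
move=> mg.
pose G (z : prodT T * T k) := (g (dfwith z.1 k z.2))%:E.
have mG : measurable_fun setT G.
  apply/measurable_EFinP; exact: (measurableT_comp mg (@measurable_dfwith _ _ T k)).
apply: (@measurableT_comp _ _ _ _ _ _ fine); first exact: fine_measurable.
apply: (eq_measurable_fun (fun x => fubini_F (mu k) (G^\+) x - fubini_F (mu k) (G^\-) x)%E).
  move=> x _; apply: esym; apply: etrans (integralE (mu k) setT (fun y => G (x, y))) _.
  by congr (_ - _)%E; apply: eq_integral => y _; rewrite ?funeposE ?funenegE.
apply: emeasurable_funB.
  apply: (@measurable_fun_fubini_tonelli_F _ _ _ _ _ (mu k) (G^\+)%E) => //.
  exact: measurable_funepos.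
apply: (@measurable_fun_fubini_tonelli_F _ _ _ _ _ (mu k) (G^\-)%E) => //.
exact: measurable_funeneg.
Qed.

(** Changes of two different coordinates commute, so the bound passes through the
integral over the k-th coordinate. *)
Lemma oscillation_le_integrate_out k (g : prodT T -> R) :
  measurable_fun setT g -> oscillation_le g -> oscillation_le (integrate_out k g).
Proof.
move=> mg og i x y; have [ik|ik] := eqVneq i k.
  have h0 : 0 <= h i y by apply: le_trans (normr_ge0 _) (og i x y).
  have gk : independent_of k (integrate_out k g) by exact: independent_of_integrate_out.
  by subst i; rewrite !gk subrr normr0.
have iS z := integrable_section k z mg og.
rewrite /integrate_out -RintegralB//; [|exact: iS|exact: iS].
have iB : (mu k).-integrable setT (EFin \o (fun z => g (dfwith (dfwith x i y) k z) -
    g (dfwith (dfwith x i (x0 i)) k z))).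
  exact: (integrableB measurableT (iS _) (iS _)).
apply: le_trans (le_normr_Rintegral measurableT iB) _.
apply: (@le_trans _ _ (\int[mu k]_(z in setT) h i y)).
  apply: le_Rintegral => //.
  - exact: (integrable_abse iB).
  - exact: (finite_measure_integrable_cst (mu k) (h i y) measurableT).
  - by move=> z _; rewrite !(dfwithC _ _ _ ik).
rewrite Rintegral_cst// -[leRHS]mulr1 le_eqVlt; apply/orP; left; apply/eqP.
by congr (_ * _); exact: (congr1 fine (probability_setT (mu k))).
Qed.

End integrate_out.

Section tensorization.
Context {I : finType} {d : I -> measure_display} {T : forall i, measurableType (d i)}.
Context {dO} {Omega : measurableType dO} {R : realType} (P : probability Omega R).
Variable X : forall i, {RV P >-> T i}.
Hypothesis indep : mutually_independent P X.
Variables (f : R -> R).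
Hypotheses (fF : F12 f) (f_neq0 : f <> cst 0).
Variables (x0 : forall i, T i) (h : forall i, T i -> R).
Arguments h : clear implicits.

Let law i : probability (T i) R := distribution P (X i).

Hypothesis ih : forall i, (law i).-integrable setT (EFin \o h i).
Hypothesis ifh : forall i, (law i).-integrable setT (EFin \o f \o h i).

Local Notation oscillation_le := (oscillation_le x0 h).
Local Notation joint := (joint X).

Lemma integrable_integrate_out k (g : prodT T -> R) :
  measurable_fun setT g -> oscillation_le g -> P.-integrable setT (EFin \o g \o joint) ->
  P.-integrable setT (EFin \o integrate_out law k g \o joint).
Proof.
move=> mg og ig; apply/integrableP; split.
  apply/measurable_EFinP; apply: (measurableT_comp _ (measurable_joint X)).
  exact: measurable_integrate_out.
move/integrableP : (ig) => [_]; apply: le_lt_trans.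
have mag : measurable_fun [set: prodT T] (fun x => `|(g x)%:E|%E).
  by apply: measurableT_comp => //; exact/measurable_EFinP.
rewrite (integral_resample indep k mag)//.
apply: ge0_le_integral => //.
- apply: measurableT_comp => //; apply/measurable_EFinP.
  apply: (measurableT_comp _ (measurable_joint X)).
  exact: measurable_integrate_out.
- apply: (@measurable_fun_fubini_tonelli_F _ _ _ _ _ (law k)
    (fun z => `|(g (@resample _ _ _ _ _ _ _ X k z))%:E|%E)) => //.
  exact: (measurableT_comp mag (@measurable_resample _ _ _ _ _ _ _ X k)).
move=> w _; have -> : (EFin \o integrate_out law k g \o joint) w =
    (\int[law k]_y (g (dfwith (joint w) k y))%:E)%E.
  exact: (EFin_integrate_out ih).
apply: le_abse_integral => //.
by apply/measurable_EFinP; exact: measurable_section.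
Qed.

Lemma expectation_integrate_out k (g : prodT T -> R) :
  measurable_fun setT g -> oscillation_le g -> P.-integrable setT (EFin \o g \o joint) ->
  (\int[P]_w (g (joint w))%:E = \int[P]_w (integrate_out law k g (joint w))%:E)%E.
Proof.
move=> mg og ig; rewrite (integral_resample_integrable indep k mg ig).
by apply: eq_integral => w _; apply: esym; exact: (EFin_integrate_out ih).
Qed.

(** Resample the k-th coordinate, then apply the one-variable inequality for fixed
values of the other coordinates. *)
Lemma moment_integrate_out k (g : prodT T -> R) :
  measurable_fun setT g -> oscillation_le g ->
  (\int[P]_w (f (g (joint w)))%:E <= \int[P]_w (f (integrate_out law k g (joint w)))%:E +
    (moment_const f)%:E * \int[law k]_y (f (h k y))%:E)%E.
Proof.
move=> mg og.
have mf : measurable_fun setT f by apply: continuous_measurable_fun; exact: F12_continuous.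
have mfg : measurable_fun [set: prodT T] (EFin \o f \o g).
  by apply/measurable_EFinP; exact: measurableT_comp.
have mfG : measurable_fun setT (fun w => (f (integrate_out law k g (joint w)))%:E).
  apply/measurable_EFinP; apply: (measurableT_comp mf).
  apply: (measurableT_comp _ (measurable_joint X)).
  exact: measurable_integrate_out.
rewrite (integral_resample indep k mfg)//; last by move=> x; rewrite lee_fin F12_ge0.
set K := (_%:E * _)%E.
have K0 : (0 <= K)%E.
  rewrite mule_ge0 ?lee_fin ?(ltW (moment_const_gt0 fF f_neq0))//.
  by apply: integral_ge0 => y _; rewrite lee_fin F12_ge0.
apply: (@le_trans _ _ (\int[P]_w ((f (integrate_out law k g (joint w)))%:E + K))%E).
  apply: ge0_le_integral => //.
  - by move=> w _; apply: integral_ge0 => y _; rewrite lee_fin F12_ge0.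
  - apply: (@measurable_fun_fubini_tonelli_F _ _ _ _ _ (law k)
      (fun z => (f (g (@resample _ _ _ _ _ _ _ X k z)))%:E)) => //.
      exact: (measurableT_comp mfg (@measurable_resample _ _ _ _ _ _ _ X k)).
    by move=> z; rewrite lee_fin F12_ge0.
  - exact: emeasurable_funD.
  - move=> w _; apply: (F12_mean_le fF f_neq0 (e0 := g (dfwith (joint w) k (x0 k)))) => //.
      exact: (integrable_section ih).
    exact: ifh.
rewrite ge0_integralD//; last by move=> w _; rewrite lee_fin F12_ge0.
rewrite leeD2l//.
by rewrite -[leRHS]mule1 -(probability_setT P) -(integral_cst P measurableT K).
Qed.

Lemma tensorization (s : seq I) (g : prodT T -> R) :
  measurable_fun setT g -> oscillation_le g -> P.-integrable setT (EFin \o g \o joint) ->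
  exists G : prodT T -> R, [/\ P.-integrable setT (EFin \o G \o joint),
    (\int[P]_w (g (joint w))%:E = \int[P]_w (G (joint w))%:E)%E,
    (forall i, independent_of i g \/ i \in s -> independent_of i G) &
    (\int[P]_w (f (g (joint w)))%:E <= \int[P]_w (f (G (joint w)))%:E +
      (moment_const f)%:E * \sum_(i <- s) \int[law i]_y (f (h i y))%:E)%E].
Proof.
elim: s g => [|k s IHs] g mg og ig.
  exists g; split=> //; first by move=> i [].
  by rewrite big_nil mule0 adde0.
have [|||G [iG eG dG leG]] := IHs (integrate_out law k g).
- exact: measurable_integrate_out.
- exact: (oscillation_le_integrate_out ih).
- exact: integrable_integrate_out.
exists G; split => //.
- by rewrite (expectation_integrate_out k).
- move=> i [gi|]; first by apply: dG; left; exact: independent_of_integrate_outW.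
  rewrite inE => /predU1P[->|si]; last by apply: dG; right.
  by apply: dG; left; exact: independent_of_integrate_out.
apply: le_trans (moment_integrate_out k mg og) _.
rewrite big_cons; set a := (\int[law k]_y (f (h k y))%:E)%E.
have a0 : (0 <= a)%E by apply: integral_ge0 => y _; rewrite lee_fin F12_ge0.
have b0 : (0 <= \sum_(i <- s) \int[law i]_y (f (h i y))%:E)%E.
  by apply: sume_ge0 => i _; apply: integral_ge0 => y _; rewrite lee_fin F12_ge0.
by rewrite (ge0_muleDr _ a0 b0) [(_ * a + _)%E]addeC addeA leeD2r.
Qed.

(** There are finitely many coordinates, and one point can be turned into the other
by changing them successively. *)
Lemma independent_of_all_cst (G : prodT T -> R) :
  (forall i, independent_of i G) -> forall x y, G x = G y.
Proof.
move=> dG x y.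
pose upd (s : seq I) : prodT T := foldr (fun i (z : prodT T) => dfwith z i (y i)) x s.
have e1 s : G (upd s) = G x by elim: s => //= i s <-; exact: dG.
have e2 s i : i \in s -> upd s i = y i.
  elim: s => //= j s IHs; have [<-|ji] := eqVneq j i; first by rewrite dfwithin.
  by rewrite inE eq_sym (negbTE ji)/= dfwithout.
rewrite -(e1 (enum I)); congr G; apply: functional_extensionality_dep => i.
by apply: e2; rewrite mem_enum.
Qed.

Lemma moment_bound (g : prodT T -> R) :
  measurable_fun setT g -> oscillation_le g -> P.-integrable setT (EFin \o g \o joint) ->
  (\int[P]_w (f (g (joint w)))%:E <= (f (fine (\int[P]_w (g (joint w))%:E)))%:E +
      (moment_const f)%:E * \sum_i \int[law i]_y (f (h i y))%:E)%E.
Proof.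
move=> mg og ig; have [G [iG eG dG]] := tensorization (enum I) mg og ig.
have cG : forall x y, G x = G y.
  by apply: independent_of_all_cst => i; apply: dG; right; rewrite mem_enum.
have icst c : (\int[P]_w c%:E = c%:E)%E.
  by rewrite -[RHS]mule1 -(probability_setT P) -(integral_cst P measurableT c%:E).
have Gc w : G (joint w) = G x0 by exact: cG.
have eGf : (\int[P]_w (f (G (joint w)))%:E = (f (G x0))%:E)%E.
  by rewrite -[RHS]icst; apply: eq_integral => w _; rewrite Gc.
have -> : (\int[P]_w (g (joint w))%:E = (G x0)%:E)%E.
  by rewrite eG -[RHS]icst; apply: eq_integral => w _; rewrite Gc.
by rewrite eGf /= big_enum.
Qed.

End tensorization.

Section separately_lipschitz_moment.
Context {I : finType} {d : I -> measure_display} {T : forall i, measurableType (d i)}.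
Context {dO} {Omega : measurableType dO} {R : realType} (P : probability Omega R).
Variable X : forall i, {RV P >-> T i}.
Hypothesis indep : mutually_independent P X.

(** A nonzero f dominates a nonconstant affine function, its tangent at 1. *)
Lemma integrable_of_F12_moment {dS} {S : measurableType dS} (Q : probability S R) (f : R -> R) (h : S -> R) :
  F12 f -> f <> cst 0 -> measurable_fun setT h -> (forall y, 0 <= h y) ->
  Q.-integrable setT (EFin \o f \o h) -> Q.-integrable setT (EFin \o h).
Proof.
move=> fF f0 mh h0 ifh.
have d0 : 0 < derive1 f 1.
  have := F12_tangent fF 1 0; have := F12_gt0 fF f0 (oner_neq0 _).
  by rewrite F12_0//; lra.
have ic : Q.-integrable setT (EFin \o cst 1) by exact: finite_measure_integrable_cst.
have iZ := integrableZl measurableT (derive1 f 1)^-1 ifh.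
apply: (le_integrable measurableT _ _ (integrableD measurableT ic iZ)).
  exact/measurable_EFinP.
move=> y _ /=; rewrite lee_fin ger0_norm//; apply: le_trans _ (ler_norm _).
rewrite mulrC -(ler_pM2r d0) mulrDl divfK ?gt_eqF// mul1r.
have := F12_tangent fF 1 (h y); have := F12_ge0 fF 1; lra.
Qed.

(** If the f-moment of some rho_i (X_i, x_i) is infinite, the right-hand side is
infinite because the constant is positive.  Otherwise the functions
rho_i (., x_i) are integrable and all the coordinates can be integrated out. *)
Lemma separately_lipschitz_moment_le (f : R -> R) (g : prodT T -> R)
    (rho : forall i, T i * T i -> R) (x : forall i, T i) :
  F12 f -> f <> cst 0 -> measurable_fun setT g ->
  (forall i, measurable_fun setT (rho i)) -> separately_lipschitz rho g ->
  P.-integrable setT (EFin \o g \o joint X) ->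
  (\int[P]_w (f (g (joint X w)))%:E <= (f (fine (\int[P]_w (g (joint X w))%:E)))%:E +
     kappa f * C_const f * \sum_i \int[P]_w (f (rho i (X i w, x i)))%:E)%E.
Proof.
move=> fF f0 mg mrho lip ig.
pose h i (y : T i) := rho i (y, x i).
have mh i : measurable_fun setT (h i).
  apply: (measurableT_comp (mrho i)); exact: pair2_measurable.
have h0 i y : 0 <= h i y.
  apply: le_trans (normr_ge0 _) (lip i x y).
have mf : measurable_fun setT f by apply: continuous_measurable_fun; exact: F12_continuous.
have mfh i : measurable_fun setT (EFin \o f \o h i).
  by apply/measurable_EFinP; exact: measurableT_comp.
have fh0 i y : (0 <= (f (h i y))%:E)%E by rewrite lee_fin F12_ge0.
have elaw i : (\int[distribution P (X i)]_y (f (h i y))%:E =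
    \int[P]_w (f (rho i (X i w, x i)))%:E)%E.
  exact: (ge0_integral_distribution (X i) (mfh i) (fh0 i)).
have -> : (kappa f * C_const f = (moment_const f)%:E)%E.
  by rewrite EFinM !fineK ?kappa_fin_num ?C_const_fin_num.
have [ifh|nifh] := pselect (forall i, (distribution P (X i)).-integrable setT (EFin \o f \o h i)).
  under eq_bigr do rewrite -elaw.
  apply: (moment_bound indep fF f0 (x0 := x)) => //.
    by move=> i; apply: integrable_of_F12_moment (ifh i).
  move=> i z y; have := lip i (dfwith z i (x i)) y.
  by rewrite dfwith_dfwith dfwithin.
have /existsNP[i nif] := nifh.
have oo : (\int[P]_w (f (rho i (X i w, x i)))%:E = +oo)%E.
  rewrite -elaw; apply/eqP; rewrite -leye_eq leNgt; apply/negP => lt.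
  apply: nif; apply/integrableP; split => //.
  by under eq_integral do rewrite /= ger0_norm ?F12_ge0//.
rewrite (bigD1 i)//= oo addye; last first.
  rewrite gt_eqF// (lt_le_trans (ltNyr 0))// sume_ge0// => j _.
  by apply: integral_ge0 => w _; rewrite lee_fin F12_ge0.
by rewrite gt0_muley ?lte_fin ?moment_const_gt0// addey// leey.
Qed.

End separately_lipschitz_moment.

(** * Power functions *)

Section abs_pow.
Context {R : realType}.
Implicit Types (p r x y c : R).

Lemma abs_pow0 p : 0 < p -> abs_pow p 0 = 0.
Proof. by move=> p0; rewrite /abs_pow normr0 powR0// gt_eqF. Qed.

Lemma abs_powN p x : abs_pow p (- x) = abs_pow p x.
Proof. by rewrite /abs_pow normrN. Qed.

Lemma abs_pow_nneg p x : 0 <= x -> abs_pow p x = x `^ p.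
Proof. by move=> x0; rewrite /abs_pow ger0_norm. Qed.

Lemma abs_pow_continuous r : 0 < r -> continuous (abs_pow r).
Proof.
move=> r0 x; have [->|xn0] := eqVneq x 0.
  rewrite /continuous_at abs_pow0//; apply/cvgrPdist_lt => e e0.
  near=> y.
  rewrite sub0r normrN /abs_pow ger0_norm ?powR_ge0//.
  have <- : (e `^ r^-1) `^ r = e by rewrite -powRrM mulVf ?gt_eqF// powRr1// ltW.
  apply: gt0_ltr_powR => //; rewrite ?nnegrE ?powR_ge0//.
  near: y.
  have h : \forall y \near (0 : R), `|y| < e `^ r^-1 by apply: nbhs0_lt; rewrite powR_gt0.
  exact: h.
have ax0 : 0 < `|x| by rewrite normr_gt0.
apply: (@continuous_comp R R R (fun t => `|t|) (fun t => t `^ r)).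
  exact: norm_continuous.
apply: differentiable_continuous; apply/derivable1_diffP.
by apply: derivable_powR; rewrite in_itv/= ax0.
Unshelve. all: by end_near. Qed.

Definition pos_part x := (x + `|x|) / 2.

Lemma pos_part_continuous : continuous pos_part.
Proof.
move=> x; apply: cvgMl; apply: cvgD; first exact: cvg_id.
exact: norm_continuous.
Qed.

(** The odd extension of a power from the half-line, written as a difference of even
powers of the positive and negative parts so that its continuity at 0 is that
of [abs_pow]. *)
Definition signed_pow r x := abs_pow r (pos_part x) - abs_pow r (pos_part (- x)).

Lemma signed_pow_continuous r : 0 < r -> continuous (signed_pow r).
Proof.
move=> r0 x; apply: cvgB.
  apply: (@continuous_comp _ _ _ pos_part (abs_pow r)); first exact: pos_part_continuous.
  exact: abs_pow_continuous.
apply: (@continuous_comp _ _ _ (fun x => pos_part (- x)) (abs_pow r)).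
  apply: (@continuous_comp _ _ _ -%R pos_part); first exact: oppr_continuous.
  exact: pos_part_continuous.
exact: abs_pow_continuous.
Qed.

Lemma signed_pow_nneg r x : 0 < r -> 0 <= x -> signed_pow r x = x `^ r.
Proof.
move=> r0 x0; rewrite /signed_pow /pos_part normrN ger0_norm// addNr mul0r abs_pow0// subr0.
by rewrite (_ : (x + x) / 2 = x) ?abs_pow_nneg//; field.
Qed.

Lemma signed_powN r x : signed_pow r (- x) = - signed_pow r x.
Proof. by rewrite /signed_pow opprK opprB. Qed.

(** At 0 the derivative comes from the continuous slope function
[signed_pow (p - 1)], since |z|^p = signed_pow (p - 1) z * z. *)
Lemma is_derive_abs_pow p x : 1 < p ->
  is_derive x 1 (abs_pow p) (p * signed_pow (p - 1) x).
Proof.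
move=> p1; have p0 : 0 < p by lra.
have r0 : 0 < p - 1 by lra.
wlog x0 : x / 0 <= x => [h|].
  have [x0|x0] := leP 0 x; first exact: h.
  have /h hx : 0 <= - x by rewrite oppr_ge0 ltW.
  have -> : abs_pow p = abs_pow p \o -%R by apply/funext => y; rewrite /= abs_powN.
  have -> : p * signed_pow (p - 1) x = p * signed_pow (p - 1) (- x) * -1.
    by rewrite signed_powN; lra.
  exact: is_derive1_comp.
have [->|xn0] := eqVneq x 0.
  apply/is_derive1_caratheodory; exists (signed_pow (p - 1)); split.
  - move=> z; rewrite abs_pow0// !subr0.
    wlog z0 : z / 0 <= z => [h|].
      have [z0|z0] := leP 0 z; first exact: h.
      rewrite -abs_powN h ?oppr_ge0 ?ltW// signed_powN; lra.
    by rewrite signed_pow_nneg// abs_pow_nneg// mulrC mulr_powRB1.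
  - exact: signed_pow_continuous.
  - by rewrite signed_pow_nneg// powR0 ?gt_eqF// mulr0.
have xgt0 : 0 < x by rewrite lt_neqAle eq_sym xn0.
rewrite signed_pow_nneg//; apply: near_eq_is_derive (is_derive1_powR p xgt0).
near=> y; rewrite abs_pow_nneg//; apply: ltW; near: y; exact: lt_nbhsr.
Unshelve. all: by end_near. Qed.

Lemma derive1_abs_pow p : 1 < p -> derive1 (abs_pow p) = (fun x => p * signed_pow (p - 1) x).
Proof.
move=> p1; apply/funext => x; rewrite derive1E.
by have h := is_derive_abs_pow x p1; exact: derive_val.
Qed.

(** Equivalent to convexity of the inverse power 1 / r, applied at x^r and y^r. *)
Lemma powR_concave r t x y : 0 < r <= 1 -> 0 <= t <= 1 -> 0 <= x -> 0 <= y ->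
  t * x `^ r + (1 - t) * y `^ r <= (t * x + (1 - t) * y) `^ r.
Proof.
move=> /andP[r0 r1] /andP[t0 t1] x0 y0.
have ti : Itv.spec (@Itv.num_sem R) (Itv.Real `[0%Z, 1%Z]) t.
  by rewrite /= /Itv.num_sem/= num_real in_itv/= t0 t1.
have r11 : 1 <= r^-1 by rewrite invf_ge1.
have powK z : 0 <= z -> (z `^ r) `^ r^-1 = z.
  by move=> z0; rewrite -powRrM mulfV ?gt_eqF// powRr1.
have := convex_powR r11 (Itv.mk ti) (x := x `^ r) (y := y `^ r).
rewrite !inE /= !in_itv /= !andbT !powR_ge0 => /(_ isT isT).
rewrite !convRE /= !powK// => h.
have e0 : 0 <= t * x `^ r + (1 - t) * y `^ r.
  by rewrite addr_ge0// mulr_ge0 ?powR_ge0//; lra.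
have -> : t * x `^ r + (1 - t) * y `^ r = ((t * x `^ r + (1 - t) * y `^ r) `^ r^-1) `^ r.
  by rewrite -powRrM mulVf ?gt_eqF// powRr1.
apply: ge0_ler_powR => //; rewrite ?nnegrE ?powR_ge0//; first exact: ltW.
by rewrite addr_ge0// mulr_ge0//; lra.
Qed.

Lemma F12_abs_pow p : 1 < p <= 2 -> F12 (abs_pow p).
Proof.
move=> /andP[p1 p2]; have r0 : 0 < p - 1 by lra.
have d1 := derive1_abs_pow p1.
split.
- split; first by move=> x; have /@ex_derive := is_derive_abs_pow x p1.
  by rewrite d1 => x; apply: cvgMr; exact: signed_pow_continuous.
- by rewrite abs_pow0//; lra.
- exact: abs_powN.
- move=> x y; rewrite !in_itv/= !andbT => x0 y0 xy.
  rewrite d1 !signed_pow_nneg// ler_pM2l; last by lra.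
  by apply: ge0_ler_powR => //; rewrite ltW.
- move=> t x y; rewrite !inE/= !in_itv/= !andbT => x0 y0.
  rewrite !convRE d1.
  have t01 : 0 <= t%:num <= 1 by rewrite ge0 le1.
  have r01 : 0 < p - 1 <= 1 by lra.
  have xy0 : 0 <= t%:num * x + (1 - t%:num) * y.
    by move/andP: t01 => [t0 t1]; rewrite addr_ge0// mulr_ge0//; lra.
  rewrite /unstable.onem !signed_pow_nneg//.
  have := powR_concave r01 t01 x0 y0; rewrite -(@ler_pM2l _ p); last by lra.
  by lra.
Qed.

Lemma abs_pow_neq0 p : abs_pow p <> cst 0.
Proof.
move=> /(congr1 (fun f => f 1)) /eqP.
by rewrite /abs_pow normr1 powR1 /= oner_eq0.
Qed.

End abs_pow.

(** * The constant of a power function as a maximum *)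

Section powR_quotient.
Context {R : realType}.

Lemma powRX (x : R) n t : 0 <= x -> (x ^+ n) `^ t = x `^ (n%:R * t).
Proof. by move=> x0; rewrite -powR_mulrn// -powRrM. Qed.

Lemma powR_div (x y t : R) : 0 <= x -> 0 < y -> (x / y) `^ t = x `^ t / y `^ t.
Proof.
move=> x0 y0; rewrite powRM ?invr_ge0 ?(ltW y0)//; congr (_ * _).
by rewrite -powR_inv1 ?(ltW y0)// -powRrM mulN1r powRN.
Qed.

End powR_quotient.

Section kappat_maximum.
Context {R : realType} (p : R).
Hypothesis p12 : 1 < p <= 2.
Implicit Types c s a : R.
Local Notation r := (p - 1).
Local Notation q := (p - 1)^-1.
Local Notation obj := (kappat_objective p).

Let p1 : 1 < p. Proof. by case/andP: p12. Qed.
Let r0 : 0 < r. Proof. by rewrite subr_gt0. Qed.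
Let r1 : r <= 1. Proof. by case/andP: p12; lra. Qed.
Let q0 : 0 < q. Proof. by rewrite invr_gt0. Qed.
Let fF := F12_abs_pow p12.
Let fn0 := @abs_pow_neq0 R p.

Definition power_sum c t : R := c `^ t + (1 - c) `^ t.

Lemma power_sum_gt0 c t : 0 < c < 1 -> 0 < power_sum c t.
Proof. by move=> /andP[c0 c1]; rewrite addr_gt0// powR_gt0//; lra. Qed.

Lemma kappat_objectiveE c : obj c = power_sum c r * power_sum c q `^ r.
Proof. by []. Qed.

Lemma kappat_objective0 : obj 0 = 1.
Proof.
by rewrite /kappat_objective subr0 !powR0 ?gt_eqF// powR1 !add0r powR1 mulr1.
Qed.

Lemma kappat_objective_half : obj (1 / 2) = 1.
Proof.
have e : (1 - 1 / 2 : R) = 1 / 2 by lra.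
have h : 0 <= (1 / 2 : R) by lra.
have hq : ((1 / 2 : R) `^ q) `^ r = 1 / 2 by rewrite -powRrM mulVf ?gt_eqF// powRr1.
have hr : (1 / 2 : R) `^ r * 2 `^ r = 1.
  by rewrite -powRM// (_ : 1 / 2 * 2 = 1 :> R) ?powR1//; field.
rewrite /kappat_objective e.
have tw (w : R) : w + w = 2 * w by lra.
by rewrite !tw powRM ?powR_ge0// hq; lra.
Qed.

Lemma kappat_objective_continuous : {within `[0, 1 / 2], continuous obj}.
Proof.
pose F c := (abs_pow r c + abs_pow r (1 - c)) * abs_pow r (abs_pow q c + abs_pow q (1 - c)).
have cF : continuous F.
  have cc t : 0 < t -> continuous (fun c : R => abs_pow t c + abs_pow t (1 - c)).
    move=> t0 x; apply: cvgD; first exact: abs_pow_continuous.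
    apply: (@continuous_comp R R R (fun c => 1 - c) (abs_pow t)).
      by apply: cvgB; [exact: cvg_cst|exact: cvg_id].
    exact: abs_pow_continuous.
  move=> x; apply: cvgM; first exact: cc.
  apply: (@continuous_comp R R R (fun c => abs_pow q c + abs_pow q (1 - c)) (abs_pow r)).
    exact: cc.
  exact: abs_pow_continuous.
apply: (@subspace_eq_continuous _ _ _ F); last exact: continuous_subspaceT.
move=> c; rewrite inE /= in_itv/= => /andP[c0 c12].
have c1 : 0 <= 1 - c by lra.
rewrite /F !(@abs_pow_nneg R _ c) ?(@abs_pow_nneg R _ (1 - c))//.
by rewrite abs_pow_nneg ?addr_ge0 ?powR_ge0.
Qed.

(** The minimizer over a of U(c, 1, a) = c u^p + (1 - c) v^p with u = 1 - c + a and
v = c - a, hence u + v = 1: at this point the two derivatives c u^(p - 1) and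
(1 - c) v^(p - 1) agree. *)
Lemma stationary_pair c : 0 < c < 1 ->
  exists u v : R, [/\ 0 < u, 0 < v /\ v = c `^ q / power_sum c q,
      u + v = 1, c * u `^ r = (1 - c) * v `^ r &
      c * u `^ r = c * (1 - c) / power_sum c q `^ r].
Proof.
move=> c01; have /andP[c0 c1] := c01; have d0 : 0 < 1 - c by rewrite subr_gt0.
have N0 := power_sum_gt0 q c01.
have e z : 0 < z -> (z `^ q / power_sum c q) `^ r = z / power_sum c q `^ r.
  by move=> z0; rewrite powR_div ?powR_ge0// -powRrM mulVf ?gt_eqF// powRr1 ?ltW.
exists ((1 - c) `^ q / power_sum c q), (c `^ q / power_sum c q); split.
- by rewrite divr_gt0// powR_gt0.
- by rewrite divr_gt0// powR_gt0.
- by rewrite -mulrDl addrC divff// gt_eqF.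
- by rewrite !e//; lra.
- by rewrite e//; lra.
Qed.

(** Bound both powers below by their tangents at the minimizer; the slopes agree,
so the linear terms cancel. *)
Lemma U_abs_pow_ge c a : 0 < c < 1 ->
  c * (1 - c) / power_sum c q `^ r <= U (abs_pow p) c 1 a.
Proof.
move=> c01; have [u [v [/ltW u0 [/ltW v0 _] uv elam <-]]] := stationary_pair c01.
have /andP[c0 c1] := c01.
have tu := F12_tangent fF u (1 - c + a).
have tv := F12_tangent fF v (c - a).
rewrite derive1_abs_pow// signed_pow_nneg// (abs_pow_nneg p u0) in tu.
rewrite derive1_abs_pow// signed_pow_nneg// (abs_pow_nneg p v0) in tv.
rewrite /U -[abs_pow p (a - c)]abs_powN opprB.
have p0 : 0 < p := lt_trans ltr01 p1.
rewrite -(mulr_powRB1 u0 p0) in tu; rewrite -(mulr_powRB1 v0 p0) in tv.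
have tu' := ler_wpM2l (ltW c0) tu.
have d0 : 0 <= 1 - c by lra.
have tv' := ler_wpM2l d0 tv.
apply: le_trans (lerD tu' tv').
set A := u `^ r in elam *; set B := v `^ r in elam *.
have -> : c * (u * A + p * A * (1 - c + a - u)) = c * A * (u + p * (1 - c + a - u)) by ring.
have -> : (1 - c) * (v * B + p * B * (c - a - v)) = (1 - c) * B * (v + p * (c - a - v)) by ring.
rewrite -elam -mulrDr.
have -> : u + p * (1 - c + a - u) + (v + p * (c - a - v)) = (u + v) + p * (1 - (u + v)) by ring.
by rewrite uv subrr mulr0 addr0 mulr1.
Qed.

Lemma U_abs_pow0 c : 0 < c < 1 ->
  U (abs_pow p) c 1 0 = c * (1 - c) / power_sum c q `^ r * obj c.
Proof.
move=> c01; have /andP[c0 c1] := c01; have d0 : 0 < 1 - c by rewrite subr_gt0.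
have N0 := powR_gt0 r (power_sum_gt0 q c01).
rewrite U0E// !abs_pow_nneg ?ltW// kappat_objectiveE [_ * _ `^ r]mulrC mulrA divfK ?gt_eqF//.
have p0 : 0 < p := lt_trans ltr01 p1.
by rewrite -(mulr_powRB1 (ltW c0) p0) -(mulr_powRB1 (ltW d0) p0) /power_sum; lra.
Qed.

Lemma U_abs_pow_scale c s a : 0 < s ->
  U (abs_pow p) c s a = s * s `^ p * U (abs_pow p) (c / s) 1 (a / s).
Proof.
move=> s0; have s0' : s != 0 by rewrite gt_eqF.
have absZ z : abs_pow p (s * z) = s `^ p * abs_pow p z.
  by rewrite /abs_pow normrM powRM ?normr_ge0// gtr0_norm.
rewrite /U (_ : s - c + a = s * (1 - c / s + a / s)); last by field.
rewrite (_ : a - c = s * (a / s - c / s)); last by field.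
by rewrite !absZ; field.
Qed.

Lemma kappa_abs_pow_le (m : R) : (forall c, 0 < c < 1 / 2 -> obj c <= m) ->
  (kappa (abs_pow p) <= m%:E)%E.
Proof.
move=> hm; apply: ge_ereal_sup => _ [s [c [a [s0 cs ac ->]]]].
have Up := U_gt0 fF fn0 s0 cs ac.
rewrite lee_fin ler_pdivrMr//.
move: Up; rewrite !(U_abs_pow_scale _ _ s0) mul0r.
have ss : 0 < s * s `^ p by rewrite mulr_gt0// powR_gt0.
rewrite pmulr_rgt0// => Up; rewrite mulrCA ler_pM2l//.
have c01 : 0 < c / s < 1 / 2 by rewrite divr_gt0//= ?ltr_pdivrMr//; lra.
have c1 : 0 < c / s < 1 by lra.
rewrite U_abs_pow0//.
have h := U_abs_pow_ge (a / s) c1.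
have M0 : 0 <= c / s * (1 - c / s) / power_sum (c / s) q `^ r.
  by rewrite divr_ge0 ?powR_ge0// mulr_ge0//; lra.
have m0 : 0 <= obj (c / s).
  rewrite kappat_objectiveE mulr_ge0 ?powR_ge0// ltW//; exact: power_sum_gt0.
apply: le_trans (ler_wpM2r m0 h) _.
by rewrite mulrC ler_pM2r//; exact: hm.
Qed.

(** For p < 2 the minimizing shift lies strictly between 0 and c, so the ratio at
this shift occurs in kappa.  For p = 2 the objective is identically 1. *)
Lemma kappa_abs_pow_ge c : 0 < c < 1 / 2 -> ((obj c)%:E <= kappa (abs_pow p))%E.
Proof.
move=> c02; have c01 : 0 < c < 1 by lra.
have /andP[c0 c1] := c01; have d0 : 0 < 1 - c by lra.
have [r1'|] := ltP r 1; last first.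
  move=> r1'; have er : r = 1 by apply/le_anti; rewrite r1 r1'.
  rewrite kappat_objectiveE er invr1 /power_sum !powRr1 ?(ltW c0) ?(ltW d0)//.
    by rewrite addrC subrK mulr1; exact: kappa_ge1.
  by rewrite addrC subrK.
have [u [v [u0 [v0 ev] uv elam elam']]] := stationary_pair c01.
have N0 := power_sum_gt0 q c01.
pose a := c - v.
have vc : v < c.
  (* After clearing the denominator, this is c^(q - 1) < (1 - c)^(q - 1). *)
  rewrite ev ltr_pdivrMr// /power_sum mulrDr.
  have q1 : 1 < q by rewrite invf_gt1.
  have eq1 z : 0 < z -> z `^ q = z * z `^ (q - 1).
    by move=> z0; rewrite mulr_powRB1// ltW.
  rewrite -ltrBlDl -{1}[c `^ q]mul1r -mulrBl !eq1// mulrCA mulrA.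
  rewrite -mulrA ltr_pM2l// ltr_pM2l//.
  by apply: gt0_ltr_powR; rewrite ?nnegrE ?subr_gt0//; lra.
have ac : 0 < a < c by rewrite /a; lra.
have Ua : U (abs_pow p) c 1 a = c * (1 - c) / power_sum c q `^ r.
  rewrite /U -[abs_pow p (a - c)]abs_powN opprB /a.
  rewrite (_ : 1 - c + (c - v) = u); last by lra.
  rewrite (_ : c - (c - v) = v); last by lra.
  have p0 : 0 < p := lt_trans ltr01 p1.
  rewrite !abs_pow_nneg ?ltW// -(mulr_powRB1 (ltW u0) p0) -(mulr_powRB1 (ltW v0) p0).
  by rewrite mulrCA [(1 - c) * _]mulrCA -elam -mulrDl uv mul1r.
apply: ereal_sup_ubound; exists 1, c, a; split => //.
rewrite U_abs_pow0// Ua mulrAC divff ?mul1r//.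
by rewrite gt_eqF// !mulr_gt0// invr_gt0 powR_gt0.
Qed.

(** The objective equals 1 <= kappa at both ends of the interval, so the maximum
over [0, 1/2] is also the supremum over the open interval. *)
Lemma kappa_abs_pow_max :
  kappa (abs_pow p) = (kappat p)%:E /\
  is_maximum [set obj c | c in `[0, 1 / 2]] (kappat p).
Proof.
have [c0 c0i hmax] := EVT_max (ltac:(lra) : 0 <= (1 / 2 : R)) kappat_objective_continuous.
have e : kappa (abs_pow p) = (obj c0)%:E.
  apply/le_anti/andP; split.
    apply: kappa_abs_pow_le => c c01; apply: hmax; rewrite in_itv/=; lra.
  move: c0i; rewrite in_itv/= => /andP[c00 c02].
  have [->|cn0] := eqVneq c0 0; first by rewrite kappat_objective0; exact: kappa_ge1.
  have [->|cn2] := eqVneq c0 (1 / 2); first by rewrite kappat_objective_half; exact: kappa_ge1.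
  by apply: kappa_abs_pow_ge; rewrite !lt_neqAle eq_sym cn0 cn2 c00.
rewrite /kappat e /=; split => //; split; first by exists c0.
by move=> _ [c ci <-]; exact: hmax.
Qed.

End kappat_maximum.

(** * Dependence of the constant on the exponent *)

Section power_sum_log_convex.
Context {R : realType} (c : R).
Hypothesis c02 : 0 < c < 1 / 2.
Implicit Types p q r s t : R.

Let c0 : 0 < c. Proof. by case/andP: c02. Qed.
Let cd : c < 1 - c. Proof. by case/andP: c02; lra. Qed.
Let d0 : 0 < 1 - c. Proof. exact: lt_trans c0 cd. Qed.
Let c01 : 0 < c < 1. Proof. by rewrite c0 /=; case/andP: c02; lra. Qed.

Definition log_power_sum t := ln (power_sum c t).

Definition log_power_sum' t :=
  (c `^ t * ln c + (1 - c) `^ t * ln (1 - c)) / power_sum c t.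

Lemma is_derive_powR_exponent (b t : R) : 0 < b ->
  is_derive t 1 (fun t => b `^ t) (b `^ t * ln b).
Proof.
move=> b0; have e : (fun t => b `^ t) = (fun t => expR (0 + ln b * t)).
  by apply/funext => u; rewrite /powR gt_eqF// add0r mulrC.
rewrite [b `^ t](congr1 (@^~ t) e) e.
exact: (is_derive_affine_comp 0 (ln b) t (@is_derive_expR R)).
Qed.

Lemma is_derive_log_power_sum t : is_derive t 1 log_power_sum (log_power_sum' t).
Proof.
rewrite /log_power_sum' mulrC; have N0 := power_sum_gt0 t c01.
apply: (@is_derive1_comp _ (@ln R) (power_sum c)); first exact: is_derive1_ln.
by apply: is_derive_fun_add; exact: is_derive_powR_exponent.
Qed.

(** The derivative of the logarithm of c^t + (1 - c)^t is a weighted mean of ln c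
and ln (1 - c), and the weight of the larger one increases with t. *)
Lemma log_power_sum'_incr : {homo log_power_sum' : s t / s < t}.
Proof.
move=> s t st; rewrite /log_power_sum'.
have Ns := power_sum_gt0 s c01; have Nt := power_sum_gt0 t c01.
rewrite ltr_pdivrMr// mulrAC ltr_pdivlMr// /power_sum.
have lcd : ln c < ln (1 - c) by rewrite ltr_ln.
have key : c `^ t * (1 - c) `^ s < c `^ s * (1 - c) `^ t.
  have [e e0 ->] : exists2 e, 0 < e & t = s + e by exists (t - s); lra.
  rewrite !powRD ?(gt_eqF c0) ?(gt_eqF d0) ?implybT//.
  rewrite mulrAC mulrA ltr_pM2l ?mulr_gt0 ?powR_gt0//.
  by apply: gt0_ltr_powR; rewrite ?nnegrE// ltW.
have : 0 < (ln (1 - c) - ln c) * (c `^ s * (1 - c) `^ t - c `^ t * (1 - c) `^ s).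
  by rewrite mulr_gt0// subr_gt0.
lra.
Qed.

Lemma log_power_sum_MVT s t : s < t ->
  exists2 x, s < x < t & log_power_sum t - log_power_sum s = log_power_sum' x * (t - s).
Proof.
move=> st.
have cphi : {within `[s, t], continuous log_power_sum}.
  apply: continuous_subspaceT; apply: derivable_continuous => x.
  by have /@ex_derive := is_derive_log_power_sum x.
have [x xst e] := MVT st (fun x _ => is_derive_log_power_sum x) cphi.
by exists x => //; move: xst; rewrite in_itv.
Qed.

Lemma log_power_sum1 : log_power_sum 1 = 0.
Proof.
by rewrite /log_power_sum /power_sum !powRr1 ?ltW// addrC subrK ln1.
Qed.

(** Let x be a point of ]r, s[ and y a point of ]1/s, 1/r[ where the derivative of
phi = [log_power_sum] is the slope of the chord, so that x < 1 < y.  As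
phi(1) = 0, convexity gives phi(1/s) <= phi'(y) (1/s - 1), and the difference
of the two sides is at least (s - r) (phi'(y) - phi'(x)). *)
Lemma log_power_sum_decr r s : 0 < r -> r < s -> s <= 1 ->
  log_power_sum s + s * log_power_sum s^-1 < log_power_sum r + r * log_power_sum r^-1.
Proof.
move=> r0 rs s1; have s0 := lt_trans r0 rs.
have [x /andP[rx xs] ex] := log_power_sum_MVT rs.
have sr : s^-1 < r^-1 by rewrite ltf_pV2.
have [y /andP[sy yr] ey] := log_power_sum_MVT sr.
have s1V : 1 <= s^-1 by rewrite invf_ge1.
have xy : log_power_sum' x < log_power_sum' y.
  by apply: log_power_sum'_incr; lra.
have chord : log_power_sum s^-1 <= log_power_sum' y * (s^-1 - 1).
  move: s1V; rewrite le_eqVlt => /predU1P[<-|s1V].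
    by rewrite log_power_sum1 subrr mulr0.
  have [z /andP[z1 zs] ez] := log_power_sum_MVT s1V.
  rewrite log_power_sum1 subr0 in ez; rewrite ez ler_pM2r ?subr_gt0//.
  by apply/ltW/log_power_sum'_incr; lra.
have rV : r * r^-1 = 1 by rewrite mulfV// gt_eqF.
have sV : s * s^-1 = 1 by rewrite mulfV// gt_eqF.
set A := log_power_sum s^-1 in ey chord *; set B := log_power_sum r^-1 in ey *.
have -> : B = A + log_power_sum' y * (r^-1 - s^-1) by lra.
have h1 : 0 < (s - r) * (log_power_sum' y - log_power_sum' x) by rewrite mulr_gt0 ?subr_gt0.
have h2 : 0 <= (s - r) * (log_power_sum' y * (s^-1 - 1) - A).
  by rewrite mulr_ge0 ?subr_ge0 ?(ltW rs).
have e1 : r * (A + log_power_sum' y * (r^-1 - s^-1)) =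
  r * A + log_power_sum' y * (1 - r * s^-1) by rewrite -rV; ring.
rewrite e1.
have e2 : (s - r) * (log_power_sum' y * (s^-1 - 1) - A) =
  log_power_sum' y * (1 - r * s^-1) - log_power_sum' y * (s - r) - (s - r) * A.
  by rewrite -{2}sV; ring.
by rewrite e2 in h2; lra.
Qed.

Lemma kappat_objective_decr p q : 1 < p -> p < q -> q <= 2 ->
  kappat_objective q c < kappat_objective p c.
Proof.
move=> p1 pq q2.
have e t : kappat_objective t c =
    expR (log_power_sum (t - 1) + (t - 1) * log_power_sum (t - 1)^-1).
  rewrite expRD /log_power_sum lnK ?posrE ?power_sum_gt0// /kappat_objective.
  rewrite -!/(power_sum c _); congr (_ * _).
  by rewrite /powR (gt_eqF (power_sum_gt0 _ c01)).
by rewrite !e ltr_expR; apply: log_power_sum_decr; lra.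
Qed.

(** This is the l^t norm of (c, 1 - c), with t = 1 / r, which decreases as t grows.
With u = 1 / s <= t, each term satisfies c^t = c^u (c^u)^(t/u - 1)
<= c^u N(u)^(t/u - 1) for N(u) = c^u + (1 - c)^u; add the two bounds. *)
Lemma power_sum_norm_le r s : 0 < r -> r <= s ->
  power_sum c r^-1 `^ r <= power_sum c s^-1 `^ s.
Proof.
move=> r0 rs; have s0 := lt_le_trans r0 rs.
have N0 t := power_sum_gt0 t c01.
have sr1 : 1 <= s / r by rewrite ler_pdivlMr ?mul1r.
have le_term b : 0 < b -> b `^ s^-1 <= power_sum c s^-1 ->
    b `^ r^-1 <= b `^ s^-1 * power_sum c s^-1 `^ (s / r - 1).
  move=> b0 bN; have {1}-> : r^-1 = s^-1 + s^-1 * (s / r - 1).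
    by field; rewrite !gt_eqF.
  rewrite powRD ?(gt_eqF b0) ?implybT// powRrM ler_pM2l ?powR_gt0//.
  by apply: ge0_ler_powR; rewrite ?nnegrE ?subr_ge0 ?powR_ge0// ltW.
have leN : power_sum c r^-1 <= power_sum c s^-1 `^ (s / r).
  rewrite -(mulr_powRB1 (ltW (N0 s^-1)) (divr_gt0 s0 r0)).
  rewrite {2}/power_sum mulrDl.
  by apply: lerD; apply: le_term; rewrite // ?lerDl ?lerDr powR_ge0.
have {2}-> : s = s / r * r by rewrite divfK// gt_eqF.
rewrite powRrM; apply: ge0_ler_powR => //; rewrite ?nnegrE ?powR_ge0 ?ltW//.
Qed.

(** A modulus of continuity in the exponent that is uniform in the base: the
logarithm of a small base is compensated by b^r, as - r ln b <= b^(- r). *)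
Lemma powR_exponent_diff_le (b r s : R) : 0 < b <= 1 -> 0 < r -> r <= s ->
  b `^ r - b `^ s <= (s - r) / r.
Proof.
move=> /andP[b0 b1] r0 rs.
have bE t : b `^ t = expR (t * ln b) by rewrite /powR gt_eqF.
have -> : s = r + (s - r) by lra.
set e := s - r; have e0 : 0 <= e by rewrite subr_ge0.
rewrite (_ : r + e - r = e); last by lra.
rewrite powRD ?(gt_eqF b0) ?implybT// -[X in X - _]mulr1 -mulrBr.
have h1 : 1 - b `^ e <= - (e * ln b).
  by have := expR_ge1Dx (e * ln b); rewrite -bE; lra.
have h2 : - (r * ln b) <= (b `^ r)^-1.
  have := expR_ge1Dx (- (r * ln b)); rewrite expRN -bE; lra.
apply: (@le_trans _ _ (b `^ r * - (e * ln b))); first by rewrite ler_pM2l ?powR_gt0.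
rewrite ler_pdivlMr// mulrC mulrCA mulrN.
have -> : - (r * (e * ln b)) = e * - (r * ln b) by ring.
rewrite mulrCA -[leRHS]mulr1 ler_wpM2l//.
by rewrite -(@mulfV _ (b `^ r)) ?gt_eqF ?powR_gt0// ler_pM2l ?powR_gt0.
Qed.

(** Only the first factor of the objective grows when the exponent decreases. *)
Lemma kappat_objective_le p q : 1 < p -> p <= q -> q <= 2 ->
  kappat_objective p c <= kappat_objective q c * (1 + 2 * (q - p) / (p - 1)).
Proof.
move=> p1 pq q2; have r0 : 0 < p - 1 by lra.
have rs : p - 1 <= q - 1 by lra.
have s1 : q - 1 <= 1 by lra.
have s0 : 0 < q - 1 by lra.
have N0 t := power_sum_gt0 t c01.
have c1 : 0 < c <= 1 by rewrite c0/= ltW//; case/andP: c01.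
have d1 : 0 < 1 - c <= 1 by rewrite d0/= gerBl ltW.
have hc := powR_exponent_diff_le c1 r0 rs.
have hd := powR_exponent_diff_le d1 r0 rs.
rewrite (_ : q - 1 - (p - 1) = q - p) in hc hd; last by lra.
have N1 : 1 <= power_sum c (q - 1).
  have := @ger_powR _ c c1 (q - 1) 1 s1.
  have := @ger_powR _ (1 - c) d1 (q - 1) 1 s1.
  rewrite !powRr1 ?(ltW c0) ?(ltW d0)// /power_sum; lra.
have e0 : 0 <= (q - p) / (p - 1) by rewrite divr_ge0 ?subr_ge0// ltW.
have hN : power_sum c (p - 1) <= power_sum c (q - 1) * (1 + 2 * (q - p) / (p - 1)).
  have : (q - p) / (p - 1) <= power_sum c (q - 1) * ((q - p) / (p - 1)) by rewrite ler_peMl.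
  rewrite /power_sum in N1 *; lra.
rewrite /kappat_objective -!/(power_sum c _) mulrAC.
by apply: ler_pM; [exact: ltW|exact: powR_ge0|exact: hN|exact: power_sum_norm_le].
Qed.

End power_sum_log_convex.

Section kappat_of_p.
Context {R : realType}.
Implicit Types (p q c : R).

Lemma kappat_ge p c : 1 < p <= 2 -> 0 <= c <= 1 / 2 -> kappat_objective p c <= kappat p.
Proof.
move=> p12 c02; have [_ [_]] := kappa_abs_pow_max p12; apply.
by exists c => //=; rewrite in_itv.
Qed.

Lemma kappat_attained p : 1 < p <= 2 ->
  exists2 c, 0 <= c <= 1 / 2 & kappat_objective p c = kappat p.
Proof.
by move=> /kappa_abs_pow_max[_ [[c /=]]]; rewrite in_itv /= => ci e _; exists c.
Qed.

Lemma kappat_ge1 p : 1 < p <= 2 -> 1 <= kappat p.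
Proof.
move=> p12; rewrite -lee_fin -(kappa_abs_pow_max p12).1.
by apply: kappa_ge1; [exact: F12_abs_pow|exact: abs_pow_neq0].
Qed.

Lemma kappat_le2 p : 1 < p <= 2 -> kappat p <= 2.
Proof.
move=> p12; rewrite -lee_fin -(kappa_abs_pow_max p12).1.
by apply: kappa_le2; [exact: F12_abs_pow|exact: abs_pow_neq0].
Qed.

(** Strict comparisons of objectives hold at interior points of the interval; at
its ends the objective is 1. *)
Lemma kappat_attained_cases p : 1 < p <= 2 ->
  kappat p = 1 \/ exists2 c, 0 < c < 1 / 2 & kappat_objective p c = kappat p.
Proof.
move=> p12; have [c /andP[c0 c2] e] := kappat_attained p12.
have [c0'|cn0] := eqVneq c 0; first by left; rewrite -e c0' kappat_objective0.
have [c2'|cn2] := eqVneq c (1 / 2); first by left; rewrite -e c2' kappat_objective_half.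
by right; exists c => //; rewrite !lt_neqAle eq_sym cn0 cn2 c0.
Qed.

Lemma kappat_objective2 c : 0 <= c <= 1 / 2 -> kappat_objective 2 c = 1.
Proof.
move=> /andP[c0 c2]; rewrite /kappat_objective (_ : 2 - 1 = 1 :> R); last by lra.
have d0 : 0 <= 1 - c by lra.
by rewrite invr1 !(powRr1 c0) !(powRr1 d0) addrC subrK powRr1// mulr1.
Qed.

Lemma kappat_2 : kappat (2 : R) = 1.
Proof.
have [|c c02 <-] := @kappat_attained 2; first by rewrite lexx; lra.
exact: kappat_objective2.
Qed.

(** The objective at c = 1/4 is strictly larger for p than for 2, where it is 1. *)
Lemma kappat_gt1 p : 1 < p < 2 -> 1 < kappat p.
Proof.
move=> /andP[p1 p2]; have c02 : 0 < (1 / 4 : R) < 1 / 2 by lra.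
rewrite -(@kappat_objective2 (1 / 4)); last by lra.
apply: lt_le_trans (kappat_objective_decr c02 p1 p2 (lexx _)) _.
by apply: kappat_ge; lra.
Qed.

Lemma kappat_decr p q : 1 < p -> p < q -> q <= 2 -> kappat q < kappat p.
Proof.
move=> p1 pq q2.
have q12 : 1 < q <= 2 by rewrite (lt_trans p1).
have [->|[c c02 <-]] := kappat_attained_cases q12.
  by apply: kappat_gt1; rewrite p1 (lt_le_trans pq).
apply: lt_le_trans (kappat_objective_decr c02 p1 pq q2) _.
by apply: kappat_ge; lra.
Qed.

Lemma kappat_le_mul p q : 1 < p -> p <= q -> q <= 2 ->
  kappat p <= kappat q * (1 + 2 * (q - p) / (p - 1)).
Proof.
move=> p1 pq q2.
have p12 : 1 < p <= 2 by rewrite p1 (le_trans pq).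
have q12 : 1 < q <= 2 by rewrite (lt_le_trans p1).
have e0 : 0 <= 2 * (q - p) / (p - 1) by rewrite divr_ge0 ?mulr_ge0 ?subr_ge0// ltW.
have [->|[c c02 <-]] := kappat_attained_cases p12.
  by have := kappat_ge1 q12; nra.
apply: le_trans (kappat_objective_le c02 p1 pq q2) _.
by rewrite ler_wpM2r ?addr_ge0//; apply: kappat_ge; lra.
Qed.

Lemma kappat_dist_le p q : 1 < p -> p <= q -> q <= 2 ->
  `|kappat p - kappat q| <= 4 / (p - 1) * (q - p).
Proof.
move=> p1 pq q2.
have q12 : 1 < q <= 2 by rewrite (lt_le_trans p1).
have kpq : kappat q <= kappat p.
  by move: pq; rewrite le_eqVlt => /predU1P[->//|pq]; apply/ltW/kappat_decr.
rewrite ger0_norm ?subr_ge0//.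
have := kappat_le_mul p1 pq q2; have := kappat_le2 q12.
have : 0 <= (q - p) / (p - 1) by rewrite divr_ge0 ?subr_ge0// ltW.
nra.
Qed.

Lemma kappat_continuous : {within `]1, 2], continuous (kappat : R -> R)}.
Proof.
apply/subspace_continuousP => x; rewrite /= in_itv/= => /andP[x1 x2].
apply/cvgrPdist_lt => e e0; rewrite near_withinE.
(* A Lipschitz constant on the part of the interval above the midpoint of 1 and x,
   where t - 1 > (x - 1) / 2. *)
pose K := 8 / (x - 1).
have K0 : 0 < K by rewrite divr_gt0 ?subr_gt0.
near=> t; rewrite /= in_itv/= => /andP[t1 t2].
have tx : (1 + x) / 2 < t by near: t; apply: lt_nbhsr; lra.
have xt : `|x - t| < e / K.
  near: t.
  by apply/nbhs_ballP; exists (e / K); rewrite //= divr_gt0.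
change (`|kappat x - kappat t| < e).
apply: (@le_lt_trans _ _ (K * `|x - t|)); last by rewrite mulrC -ltr_pdivlMr.
have [lext|/ltW letx] := leP x t.
  apply: le_trans (kappat_dist_le x1 lext t2) _.
  rewrite distrC (ger0_norm (_ : 0 <= t - x)) ?subr_ge0// ler_wpM2r ?subr_ge0//.
  by rewrite ler_pM2r ?invr_gt0 ?subr_gt0//; lra.
rewrite distrC; apply: le_trans (kappat_dist_le t1 letx x2) _.
rewrite (ger0_norm (_ : 0 <= x - t)) ?subr_ge0// ler_wpM2r ?subr_ge0//.
by rewrite ler_pdivrMr ?subr_gt0// mulrAC ler_pdivlMr ?subr_gt0//; lra.
Unshelve. all: by end_near. Qed.

(** The second factor of the objective is at least 1 - c, and the first is at least
2 c^(p - 1) >= 2 (1 + (p - 1) ln c). *)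
Lemma kappat_ge_linear p c : 1 < p <= 2 -> 0 < c < 1 / 2 ->
  2 * (1 - c) * (1 + (p - 1) * ln c) <= kappat p.
Proof.
move=> p12 c02; have /andP[c0 c2] := c02; have /andP[p1 p2] := p12.
have r0 : 0 < p - 1 by rewrite subr_gt0.
have d0 : 0 < 1 - c by lra.
have c01 : 0 < c < 1 by lra.
apply: (@le_trans _ _ (kappat_objective p c)); last by apply: kappat_ge => //; lra.
have hd : 1 - c <= power_sum c (p - 1)^-1 `^ (p - 1).
  have {1}-> : 1 - c = ((1 - c) `^ (p - 1)^-1) `^ (p - 1).
    by rewrite -powRrM mulVf ?gt_eqF// powRr1// ltW.
  apply: ge0_ler_powR; rewrite ?nnegrE ?powR_ge0 ?(ltW r0)//.
    by rewrite ltW// power_sum_gt0.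
  by rewrite /power_sum lerDr powR_ge0.
have h1 : 1 + (p - 1) * ln c <= c `^ (p - 1).
  by rewrite /powR gt_eqF// expR_ge1Dx.
have h2 : c `^ (p - 1) <= (1 - c) `^ (p - 1).
  by apply: ge0_ler_powR; rewrite ?nnegrE ?(ltW r0) ?(ltW c0) ?(ltW d0)//; lra.
have h3 : 2 * c `^ (p - 1) <= power_sum c (p - 1) by rewrite /power_sum; lra.
rewrite /kappat_objective -!/(power_sum c _).
apply: (@le_trans _ _ (power_sum c (p - 1) * (1 - c))).
  apply: le_trans (ler_wpM2r (ltW d0) h3).
  have := ler_wpM2r (ltW d0) h1; lra.
by rewrite ler_pM2l// power_sum_gt0.
Qed.

Lemma kappat_cvg_2 : kappat p @[p --> (1 : R)^'+] --> (2 : R).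
Proof.
apply/cvgrPdist_le => e e0.
(* With c <= e / 4 and - (p - 1) ln c <= e / 4, the lower bound
   2 (1 - c) (1 + (p - 1) ln c) is at least 2 - e. *)
pose c := Num.min (1 / 4) (e / 4).
have c0 : 0 < c by rewrite lt_min; apply/andP; split; lra.
have c4 : c <= 1 / 4 by rewrite ge_min lexx.
have ce : c <= e / 4 by rewrite ge_min lexx orbT.
have lnc : ln c < 0 by rewrite ln_lt0//; lra.
pose delta := e / (4 * - ln c).
have delta0 : 0 < delta by rewrite divr_gt0// mulr_gt0// oppr_gt0.
near=> p.
have p1 : 1 < p by near: p; exact: nbhs_right_gt.
have p2 : p <= 2 by apply: ltW; near: p; apply: nbhs_right_lt; lra.
have pd : p - 1 < delta.
  rewrite ltrBlDl; near: p; apply: nbhs_right_lt; lra.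
have p12 : 1 < p <= 2 by rewrite p1.
rewrite ger0_norm ?subr_ge0 ?kappat_le2//.
have := @kappat_ge_linear p c p12 ltac:(lra).
have h : (p - 1) * - ln c <= e / 4.
  have -> : e / 4 = delta * - ln c by rewrite /delta; field; rewrite lt_eqF.
  by rewrite ler_pM2r ?oppr_gt0// ltW.
have h' : 0 <= (p - 1) * - ln c by apply: mulr_ge0; [rewrite subr_ge0 ltW|rewrite oppr_ge0 ltW].
set z := (p - 1) * - ln c in h h' *.
have -> : (p - 1) * ln c = - z by rewrite /z mulrN opprK.
have := mulr_ge0 (ltW c0) h'; lra.
Unshelve. all: by end_near. Qed.

End kappat_of_p.

(** * Algebraicity for rational exponents *)

Section algebraic_maximum.
Context {R : realType}.
Local Notation ratrR := (ratr : rat -> R).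
Local Notation algebraic := (algebraicOver ratrR).
Local Notation "p ^ratr" := (map_poly ratrR p) (at level 2, format "p ^ratr").

Lemma algebraic_horner (p : {poly rat}) (z : R) : algebraic z -> algebraic p^ratr.[z].
Proof.
move=> az; elim/poly_ind: p => [|p c IHp]; first by rewrite rmorph0 horner0; exact: algebraic0.
rewrite rmorphD rmorphM /= map_polyX map_polyC hornerMXaddC.
by apply: algebraic_add; [exact: algebraic_mul|exact: algebraic_id].
Qed.

Lemma algebraic_exp_inv (x : R) n : (0 < n)%N -> algebraic (x ^+ n) -> algebraic x.
Proof.
move=> n0 axn; apply/integral_algebraic.
apply: (@integral_root _ _ _ ('X^n - (x ^+ n)%:P)).
- by rewrite monic_neq0// monicXnsubC.
- by rewrite rootE !hornerE subrr.
- apply/integral_poly => i; rewrite coefB coefXn coefC.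
  apply/integral_algebraic/algebraic_sub.
    by case: (i == n); rewrite ?mulr1n ?mulr0n; [exact: algebraic1|exact: algebraic0].
  by case: (i == 0%N) => //; exact: algebraic0.
Qed.

Variables A B : {poly rat}.
Hypothesis B_gt0 : forall z : R, 0 <= z <= 1 -> 0 < B^ratr.[z].

Let F (z : R) := A^ratr.[z] / B^ratr.[z].
Let W := A^`() * B - A * B^`().

Lemma is_derive_quotient (z : R) : 0 <= z <= 1 -> is_derive z 1 F (W^ratr.[z] / B^ratr.[z] ^+ 2).
Proof.
move=> z01; have Bz : B^ratr.[z] != 0 by rewrite gt_eqF// B_gt0.
have dV := @is_deriveV _ (horner B^ratr) z _ 1 Bz (is_derive_poly _ z).
have := is_derive_fun_mul (is_derive_poly A^ratr z) dV.
congr (is_derive _ _ _ _).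
rewrite /W rmorphB !rmorphM /= -!deriv_map !hornerE /GRing.scale /=.
by field.
Qed.

(** The numerator W of the derivative vanishes at the maximizer z0.  If W is a
nonzero polynomial then z0 is algebraic; if W = 0 then F is constant and
equal to its rational value at 0. *)
Lemma algebraic_quotient_max z0 : 0 < z0 < 1 ->
  (forall z, 0 < z < 1 -> F z <= F z0) -> algebraic (F z0).
Proof.
move=> z01 Fmax; have z01' : 0 <= z0 <= 1 by lra.
have F0 : is_derive z0 1 F 0.
  apply: (@derive1_at_max _ F 0 1).
  - exact: ler01.
  - move=> t; rewrite in_itv/= => t01.
    have t01' : 0 <= t <= 1 by lra.
    by have /@ex_derive := is_derive_quotient t01'.
  - by rewrite in_itv.
  - by move=> t; rewrite in_itv/=; exact: Fmax.
have W0 : W^ratr.[z0] = 0.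
  have dF := is_derive_quotient z01'.
  have : W^ratr.[z0] / B^ratr.[z0] ^+ 2 = 0.
    by rewrite -(@derive_val _ _ _ _ _ _ _ dF) (@derive_val _ _ _ _ _ _ _ F0).
  move=> /eqP; rewrite mulf_eq0 invr_eq0 expf_eq0/=.
  by rewrite (gt_eqF (B_gt0 z01')) orbF => /eqP.
have [WP0|Wn0] := eqVneq W 0; last first.
  have az : algebraic z0 by exists W => //; rewrite rootE W0.
  by apply: algebraic_div; exact: algebraic_horner.
have dF z : z \in `]0, z0[ -> is_derive z 1 F 0.
  rewrite in_itv/= => /andP[z1 z2]; have z12 : 0 <= z <= 1 by lra.
  by have := is_derive_quotient z12; rewrite WP0 rmorph0 horner0 mul0r.
have cF : {within `[0, z0], continuous F}.
  apply: derivable_within_continuous => z; rewrite in_itv/= => /andP[z1 z2].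
  have z12 : 0 <= z <= 1 by lra.
  by have /@ex_derive := is_derive_quotient z12.
have /andP[z0gt0 _] := z01.
have [z _ ] := MVT z0gt0 dF cF; rewrite mul0r => /eqP; rewrite subr_eq0 => /eqP ->.
by apply: algebraic_div; apply: algebraic_horner; exact: algebraic0.
Qed.

End algebraic_maximum.

Section kappat_algebraic.
Context {R : realType} (a b : nat).
Hypotheses (a0 : (0 < a)%N) (b0 : (0 < b)%N).
Let r : R := a%:R / b%:R.

(** Solution c of c / (1 - c) = z^(ab); it maps ]0, 1[ onto ]0, 1/2[ and makes
both c^(a/b) and c^(b/a) monomials in z, up to powers of 1 - c. *)
Definition chart (z : R) : R := z ^+ (a * b) / (1 + z ^+ (a * b)).

Definition objective_num : {poly rat} :=
  (1 + 'X^(a * a)) ^+ b * (1 + 'X^(b * b)) ^+ a.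

Definition objective_den : {poly rat} := (1 + 'X^(a * b)) ^+ (a + b).

Let aR : (a%:R : R) != 0. Proof. by rewrite pnatr_eq0 -lt0n. Qed.
Let bR : (b%:R : R) != 0. Proof. by rewrite pnatr_eq0 -lt0n. Qed.
Let r0 : 0 < r. Proof. by rewrite divr_gt0// ltr0n. Qed.

Lemma objective_numE (z : R) :
  (map_poly (ratr : rat -> R) objective_num).[z] =
  (1 + z ^+ (a * a)) ^+ b * (1 + z ^+ (b * b)) ^+ a.
Proof. by rewrite rmorphM !rmorphXn !rmorphD/= !rmorph1 !map_polyXn !hornerE. Qed.

Lemma objective_denE (z : R) :
  (map_poly (ratr : rat -> R) objective_den).[z] = (1 + z ^+ (a * b)) ^+ (a + b).
Proof. by rewrite rmorphXn rmorphD/= rmorph1 map_polyXn !hornerE. Qed.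

Lemma chart_itv (z : R) : 0 < z < 1 -> 0 < chart z < 1 / 2.
Proof.
move=> /andP[z0 z1]; have zn : 0 < z ^+ (a * b) by rewrite exprn_gt0.
have zn1 : z ^+ (a * b) < 1 by rewrite exprn_ilt1 ?(ltW z0)// -lt0n muln_gt0 a0.
by rewrite divr_gt0 ?addr_gt0//= ltr_pdivrMr ?addr_gt0//; lra.
Qed.

Lemma chart_surj (c : R) : 0 < c < 1 / 2 -> exists2 z, 0 < z < 1 & chart z = c.
Proof.
move=> /andP[c0 c2]; have d0 : 0 < 1 - c by lra.
have w0 : 0 < c / (1 - c) by rewrite divr_gt0.
have w1 : c / (1 - c) < 1 by rewrite ltr_pdivrMr//; lra.
have ab0 : 0 < ((a * b)%:R : R) by rewrite ltr0n muln_gt0 a0.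
exists ((c / (1 - c)) `^ ((a * b)%:R)^-1).
  have e1 : 1 `^ ((a * b)%:R)^-1 = 1 :> R by rewrite powR1.
  rewrite powR_gt0//= -[X in _ < X]e1.
  by apply: gt0_ltr_powR; rewrite ?invr_gt0 ?nnegrE ?ler01 ?(ltW w0).
rewrite /chart -powR_mulrn ?powR_ge0// -powRrM mulVf ?gt_eqF// powRr1 ?ltW//.
by field; rewrite gt_eqF//; lra.
Qed.

(** With D = 1 + z^(ab), the objective is
(1 + z^(aa)) (1 + z^(bb))^(a/b) / D^(1 + a/b). *)
Lemma kappat_objective_chart (z : R) : 0 < z < 1 ->
  kappat_objective (1 + r) (chart z) ^+ b =
  (map_poly (ratr : rat -> R) objective_num).[z] / (map_poly (ratr : rat -> R) objective_den).[z].
Proof.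
move=> /andP[z0 z1]; set D := 1 + z ^+ (a * b).
have zn0 n : 0 <= z ^+ n by rewrite exprn_ge0 ?ltW.
have D0 : 0 < D by rewrite addr_gt0// exprn_gt0.
have dE : 1 - chart z = 1 / D.
  rewrite -{1}[1](@divff _ D) ?gt_eqF// /chart -/D -mulrBl.
  by rewrite /D addrK.
have cE t n : (a * b)%:R * t = n%:R -> chart z `^ t = z ^+ n / D `^ t.
  by move=> e; rewrite /chart powR_div// powRX ?ltW// e powR_mulrn ?ltW.
have dE' t : (1 - chart z) `^ t = 1 / D `^ t by rewrite dE powR_div// powR1.
have e1 : (a * b)%:R * r = (a * a)%:R :> R by rewrite /r !natrM; field.
have e2 : (a * b)%:R * r^-1 = (b * b)%:R :> R.
  by rewrite /r !natrM; field; rewrite bR.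
rewrite /kappat_objective (_ : 1 + r - 1 = r); last by lra.
rewrite (cE _ _ e1) (cE _ _ e2) !dE' -!mulrDl.
rewrite powR_div ?addr_ge0 ?powR_gt0// -powRrM mulVf ?gt_eqF// powRr1 ?ltW//.
rewrite !exprMn !exprVn -[(_ `^ r) ^+ b]powR_mulrn ?powR_ge0// -powRrM.
rewrite -[(_ `^ r) ^+ b]powR_mulrn ?powR_ge0// -powRrM.
rewrite (_ : r * b%:R = a%:R); last by rewrite /r divfK.
rewrite !powR_mulrn ?addr_ge0 ?(ltW D0)// objective_numE objective_denE -/D exprD.
rewrite ![z ^+ _ + 1]addrC invfM; ring.
Qed.

Lemma kappat_algebraic_ratio : (a <= b)%N ->
  algebraicOver (ratr : rat -> R) (kappat (1 + r)).
Proof.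
move=> ab; have p12 : 1 < 1 + r <= 2.
  by rewrite ltrDl r0/= -lerBrDl ler_pdivrMr ?ltr0n//; have := ab; rewrite -(ler_nat R); lra.
have [->|[c c02 cE]] := kappat_attained_cases p12; first exact: algebraic1.
have [z z01 zc] := chart_surj c02.
apply: (algebraic_exp_inv b0); rewrite -cE -zc kappat_objective_chart//.
apply: algebraic_quotient_max => //.
  move=> x /andP[x0 _]; rewrite objective_denE exprn_gt0//.
  by rewrite ltr_wpDr ?exprn_ge0.
move=> x x01; rewrite -(kappat_objective_chart x01) -(kappat_objective_chart z01) zc cE.
have cx := chart_itv x01.
have o0 : 0 <= kappat_objective (1 + r) (chart x).
  by rewrite mulr_ge0 ?powR_ge0// addr_ge0 ?powR_ge0.
apply: lerXn2r; rewrite ?nnegrE ?(le_trans ler01 (kappat_ge1 p12))//.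
by apply: (kappat_ge p12); case/andP: cx => /ltW -> /ltW ->.
Qed.

End kappat_algebraic.

Lemma kappat_algebraic (R : realType) (q : rat) : 1 < q <= 2 ->
  algebraicOver (ratr : rat -> R) (kappat (ratr q)).
Proof.
move=> /andP[q1 q2].
have q0 : 0 < q - 1 by rewrite subr_gt0.
have nq : 0 < numq (q - 1) by rewrite numq_gt0.
pose a := `|numq (q - 1)|%N; pose b := `|denq (q - 1)|%N.
have aE : (a%:R : rat) = (numq (q - 1))%:~R by rewrite -[in RHS](gtz0_abs nq).
have bE : (b%:R : rat) = (denq (q - 1))%:~R by rewrite -[in RHS](gtz0_abs (denq_gt0 _)).
have qE : q = 1 + a%:R / b%:R by rewrite aE bE divq_num_den; ring.
have a0 : (0 < a)%N by rewrite absz_gt0 gt_eqF.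
have b0 : (0 < b)%N by rewrite absz_gt0 denq_neq0.
have -> : (ratr q : R) = 1 + a%:R / b%:R.
  by rewrite qE rmorphD rmorph1 fmorph_div/= !ratr_nat.
apply: kappat_algebraic_ratio => //.
have b0' : 0 < (b%:R : rat) by rewrite ltr0n.
have : a%:R / b%:R <= 1 :> rat by move: q2; rewrite qE; lra.
by rewrite ler_pdivrMr// mul1r ler_nat.
Qed.

(** * The exponent 3/2 *)

Section three_halves.
Context {R : realType}.
Implicit Types c t : R.
Local Notation s7 := (Num.sqrt 7 : R).

Definition objective32 c : R :=
  (Num.sqrt c + Num.sqrt (1 - c)) * Num.sqrt (c ^+ 2 + (1 - c) ^+ 2).

Definition argmax32 : R := (3 - Num.sqrt (1 + 2 * s7)) / 6.

Lemma kappat_objective32 c : 0 <= c <= 1 -> kappat_objective (3 / 2) c = objective32 c.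
Proof.
move=> /andP[c0 c1]; have d0 : 0 <= 1 - c by rewrite subr_ge0.
rewrite /kappat_objective (_ : 3 / 2 - 1 = 2^-1 :> R); last by field.
rewrite invrK !(powR12_sqrt c0) !(powR12_sqrt d0) -[2]/(2%:R) !powR_mulrn//.
by rewrite powR12_sqrt// addr_ge0// sqr_ge0.
Qed.

Let s7sq : s7 ^+ 2 = 7. Proof. by rewrite sqr_sqrtr. Qed.
Let s7_itv : 2 < s7 < 3.
Proof.
have s0 : 0 <= s7 by exact: sqrtr_ge0.
have := s7sq; rewrite expr2 => h; apply/andP; split; nra.
Qed.

Lemma objective32_sqr c : 0 <= c <= 1 ->
  objective32 c ^+ 2 = (1 + 2 * Num.sqrt (c * (1 - c))) * (1 - 2 * (c * (1 - c))).
Proof.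
move=> /andP[c0 c1]; have d0 : 0 <= 1 - c by rewrite subr_ge0.
rewrite exprMn sqr_sqrtr ?addr_ge0 ?sqr_ge0// sqrrD !sqr_sqrtr// sqrtrM//.
ring.
Qed.

(** With t1 = (sqrt 7 - 1) / 6, the critical point of the cubic, the difference of
the two sides is 4 (t - t1)^2 (t + 1/2 + 2 t1). *)
Lemma cubic_le t : 0 <= t ->
  (1 + 2 * t) * (1 - 2 * t ^+ 2) <= (17 + 7 * s7) / 27.
Proof.
move=> t0; pose t1 : R := (s7 - 1) / 6.
have t10 : 0 <= t1 by rewrite /t1; case/andP: s7_itv; lra.
have : 0 <= 4 * (t - t1) ^+ 2 * (t + (1 / 2 + 2 * t1)).
  have e0 : 0 <= t + (1 / 2 + 2 * t1) by lra.
  by apply: mulr_ge0 e0; rewrite mulr_ge0 ?sqr_ge0.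
have -> : 4 * (t - t1) ^+ 2 * (t + (1 / 2 + 2 * t1)) =
    (17 + 7 * s7) / 27 - (1 + 2 * t) * (1 - 2 * t ^+ 2) +
    (s7 ^+ 2 - 7) * (s7 / 27 - t / 3 - 1 / 18).
  by rewrite /t1; field.
by rewrite s7sq subrr mul0r addr0 subr_ge0.
Qed.

Lemma objective32_ge0 c : 0 <= objective32 c.
Proof. by rewrite mulr_ge0 ?addr_ge0 ?sqrtr_ge0. Qed.

Lemma max32_sqr : (Num.sqrt (51 + 21 * s7) / 9) ^+ 2 = (17 + 7 * s7) / 27.
Proof.
rewrite exprMn sqr_sqrtr; first by field.
by rewrite addr_ge0// mulr_ge0// sqrtr_ge0.
Qed.

Lemma max32_ge0 : 0 <= Num.sqrt (51 + 21 * s7) / 9 :> R.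
Proof. by rewrite divr_ge0 ?sqrtr_ge0. Qed.

Lemma objective32_le c : 0 <= c <= 1 -> objective32 c <= Num.sqrt (51 + 21 * s7) / 9.
Proof.
move=> c01; have /andP[c0 c1] := c01.
rewrite -(@ler_pXn2r _ 2) ?nnegrE ?objective32_ge0 ?max32_ge0//.
rewrite max32_sqr objective32_sqr//.
have := cubic_le (sqrtr_ge0 (c * (1 - c))).
by rewrite sqr_sqrtr// mulr_ge0// subr_ge0.
Qed.

Lemma argmax32_itv : 0 <= argmax32 <= 1 / 2.
Proof.
have w0 : 0 <= Num.sqrt (1 + 2 * s7) by exact: sqrtr_ge0.
have w3 : Num.sqrt (1 + 2 * s7) <= 3.
  have s70 : 0 <= 1 + 2 * s7 by rewrite addr_ge0// mulr_ge0// sqrtr_ge0.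
  rewrite -(@ler_pXn2r _ 2) ?nnegrE// sqr_sqrtr//.
  by case/andP: s7_itv; lra.
rewrite /argmax32; lra.
Qed.

(** Here c (1 - c) = t1^2 for the critical point t1 = (sqrt 7 - 1) / 6 of
[cubic_le]. *)
Lemma objective32_argmax : objective32 argmax32 = Num.sqrt (51 + 21 * s7) / 9.
Proof.
have /andP[c0 c2] := argmax32_itv.
have c01 : 0 <= argmax32 <= 1 by lra.
have s70 : 0 <= 1 + 2 * s7 by rewrite addr_ge0// mulr_ge0// sqrtr_ge0.
have prod : argmax32 * (1 - argmax32) = ((s7 - 1) / 6) ^+ 2.
  rewrite /argmax32; have := sqr_sqrtr s70; set w := Num.sqrt (1 + 2 * s7) => ew.
  rewrite (_ : _ * _ = (9 - w ^+ 2) / 36); last by field.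
  rewrite ew (_ : ((s7 - 1) / 6) ^+ 2 = (s7 ^+ 2 - 2 * s7 + 1) / 36); last by field.
  by rewrite s7sq; field.
have t10 : 0 <= (s7 - 1) / 6 by case/andP: s7_itv; lra.
apply/eqP; rewrite -(@eqrXn2 _ 2) ?objective32_ge0 ?max32_ge0//.
rewrite max32_sqr objective32_sqr// prod sqrtr_sqr ger0_norm//; apply/eqP.
apply/eqP; rewrite -subr_eq0; apply/eqP.
(* As polynomials in s7 the two values differ by a multiple of 7 - s7^2. *)
transitivity ((7 - s7 ^+ 2) * (s7 / 54)); last by rewrite s7sq subrr mul0r.
by field.
Qed.

Lemma kappat_32 : kappat (3 / 2 : R) = Num.sqrt (51 + 21 * s7) / 9.
Proof.
have p12 : 1 < (3 / 2 : R) <= 2 by lra.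
apply/le_anti/andP; split.
  have [c c02 <-] := kappat_attained p12.
  have c01 : 0 <= c <= 1 by lra.
  by rewrite kappat_objective32//; exact: objective32_le.
have /andP[c0 c2] := argmax32_itv.
rewrite -objective32_argmax -kappat_objective32; last by lra.
by apply: kappat_ge => //; exact: argmax32_itv.
Qed.

End three_halves.

(** * Moments of separately Lipschitz functions *)

Lemma expectation_le (R : realType) (n : nat) (d : 'I_n -> measure_display)
    (T : forall i, measurableType (d i)) (dO : measure_display)
    (Omega : measurableType dO) (P : probability Omega R)
    (X : forall i, {RV P >-> T i}) (g : prodT T -> R)
    (rho : forall i, T i * T i -> R) (f : R -> R) (x : forall i, T i) :
  mutually_independent P X -> measurable_fun setT g ->
  (forall i, measurable_fun setT (rho i)) -> separately_lipschitz rho g ->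
  P.-integrable setT (EFin \o (fun w => g (fun i => X i w))) ->
  F12 f -> f <> cst 0 ->
  ('E_P[f \o (fun w => g (fun i => X i w))] <=
    (f (fine 'E_P[fun w => g (fun i => X i w)]))%:E +
    kappa f * C_const f * \sum_(i < n) 'E_P[fun w => f (rho i (X i w, x i))])%E.
Proof.
move=> indep mg mrho lip ig fF f0.
rewrite expectation.unlock.
exact: (separately_lipschitz_moment_le indep x fF f0 mg mrho lip ig).
Qed.

Theorem corollary1p9 (R : realType) :
  (forall (n : nat) (d : 'I_n -> measure_display)
      (T : forall i, measurableType (d i))
      (dO : measure_display) (Omega : measurableType dO)
      (P : probability Omega R) (X : forall i, {RV P >-> T i})
      (g : prodT T -> R) (rho : forall i, T i * T i -> R)
      (Y : Omega -> R),
    mutually_independent P X ->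
    measurable_fun setT g ->
    (forall i, measurable_fun setT (rho i)) ->
    separately_lipschitz rho g ->
    Y = (fun w => g (fun i => X i w)) ->
    P.-integrable setT (EFin \o Y) ->
    forall x : (forall i, T i),
      (forall f : R -> R, F12 f -> f <> cst 0 ->
        ('E_P[f \o Y] <= (f (fine 'E_P[Y]))%:E +
          kappa f * C_const f *
          \sum_(i < n) 'E_P[fun w => f (rho i (X i w, x i))])%E)
      /\
      (forall p : R, 1 < p <= 2 ->
        ('E_P[fun w => (`|Y w| `^ p)%R] <= (`|fine 'E_P[Y]| `^ p)%R%:E +
          (kappat p)%:E * C_const (abs_pow p) *
          \sum_(i < n) 'E_P[fun w => (`|rho i (X i w, x i)| `^ p)%R])%E))
  /\
  (forall f : R -> R, F12 f -> f <> cst 0 -> (1 <= kappa f <= 2%:E)%E)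
  /\
  (forall p : R, 1 < p <= 2 ->
    kappa (abs_pow p) = (kappat p)%:E /\
    is_maximum [set kappat_objective p c | c in `[0, 1 / 2]] (kappat p))
  /\
  [/\ {within `]1, 2], continuous (kappat : R -> R)},
      {in `]1, 2] &, forall p q : R, p < q -> kappat q < kappat p},
      kappat p @[p --> (1 : R)^'+] --> (2 : R) &
      kappat (2 : R) = 1]
  /\
  (forall q : rat, 1 < q <= 2 ->
    algebraicOver (ratr : rat -> R) (kappat (ratr q)))
  /\
  (let c0 : R := (3 - Num.sqrt (1 + 2 * Num.sqrt 7)) / 6 in
   let h (c : R) : R :=
     (Num.sqrt c + Num.sqrt (1 - c)) * Num.sqrt (c ^+ 2 + (1 - c) ^+ 2) in
   [/\ kappat (3 / 2 : R) = Num.sqrt (51 + 21 * Num.sqrt 7) / 9,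
       is_maximum [set h c | c in `[0, 1 / 2]] (kappat (3 / 2)),
       0 <= c0 <= 1 / 2 &
       h c0 = kappat (3 / 2)]).
Proof.
have F12p (p : R) : 1 < p <= 2 -> F12 (abs_pow p) /\ abs_pow p <> cst 0.
  by move=> p12; split; [exact: F12_abs_pow|exact: abs_pow_neq0].
split; [|split; [|split; [|split; [|split]]]].
- move=> n d T dO Omega P X g rho Y indep mg mrho lip -> ig x; split.
    by move=> f fF f0; exact: expectation_le.
  move=> p p12; have [fF f0] := F12p p p12.
  rewrite -(kappa_abs_pow_max p12).1.
  exact: (@expectation_le _ _ _ _ _ _ P X g rho (abs_pow p)).
- by move=> f fF f0; rewrite kappa_ge1 ?kappa_le2.
- by move=> p p12; exact: kappa_abs_pow_max.
- split.
  + exact: kappat_continuous.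
  + move=> p q; rewrite !in_itv/= => /andP[p1 _] /andP[_ q2] pq.
    exact: kappat_decr.
  + exact: kappat_cvg_2.
  + exact: kappat_2.
- by move=> q q12; exact: kappat_algebraic.
- split.
  + exact: kappat_32.
  + split.
      exists argmax32; first by rewrite /= in_itv/= argmax32_itv.
      by rewrite kappat_32 -objective32_argmax.
    move=> _ [c' + <-]; rewrite /= in_itv/= => c'02.
    rewrite kappat_32; apply: objective32_le; lra.
  + exact: argmax32_itv.
  + by rewrite kappat_32 -objective32_argmax.
Qed.
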